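(* Let $\mathcal{M}$ be a finite unitary magma. Then the operad $\mathsf{NC}\mathcal{M}$ admits the presentation $(\mathcal{T}_{\mathcal{M}},\mathfrak{R}_{\mathsf{NC}\mathcal{M}})$, where $\mathcal{T}_{\mathcal{M}}$ is the set of all $\mathcal{M}$-triangles (in arity $2$) and $\mathfrak{R}_{\mathsf{NC}\mathcal{M}}$ is the subspace of $\mathrm{Free}(\mathrm{Vect}(\mathcal{T}_{\mathcal{M}}))(3)$ generated by the elements $$T(\mathfrak{p}_0;\mathfrak{p}_1,\mathfrak{p}_2)\circ_1T(\mathfrak{q}_0;\mathfrak{q}_1,\mathfrak{q}_2)-T(\mathfrak{p}_0;\mathfrak{r}_1,\mathfrak{p}_2)\circ_1T(\mathfrak{r}_0;\mathfrak{q}_1,\mathfrak{q}_2)\quad\text{if }\mathfrak{p}_1\star\mathfrak{q}_0=\mathfrak{r}_1\star\mathfrak{r}_0\ne\mathds{1}_{\mathcal{M}},$$ $$T(\mathfrak{p}_0;\mathfrak{p}_1,\mathfrak{p}_2)\circ_1T(\mathfrak{q}_0;\mathfrak{q}_1,\mathfrak{q}_2)-T(\mathfrak{p}_0;\mathfrak{q}_1,\mathfrak{r}_2)\circ_2T(\mathfrak{r}_0;\mathfrak{q}_2,\mathfrak{p}_2)\quad\text{if }\mathfrak{p}_1\star\mathfrak{q}_0=\mathfrak{r}_2\star\mathfrak{r}_0=\mathds{1}_{\mathcal{M}},$$ $$T(\mathfrak{p}_0;\mathfrak{p}_1,\mathfrak{p}_2)\circ_2T(\mathfrak{q}_0;\mathfrak{q}_1,\mathfrak{q}_2)-T(\mathfrak{p}_0;\mathfrak{p}_1,\mathfrak{r}_2)\circ_2T(\mathfrak{r}_0;\mathfrak{q}_1,\mathfrak{q}_2)\quad\text{if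 }\mathfrak{p}_2\star\mathfrak{q}_0=\mathfrak{r}_2\star\mathfrak{r}_0\ne\mathds{1}_{\mathcal{M}},$$ where all $\mathfrak{p}_j,\mathfrak{q}_j,\mathfrak{r}_j$ range over $\mathcal{M}$. That is, $\mathsf{NC}\mathcal{M}$ is isomorphic to $\mathrm{Free}(\mathrm{Vect}(\mathcal{T}_{\mathcal{M}}))/\langle\mathfrak{R}_{\mathsf{NC}\mathcal{M}}\rangle$.
   Context: All vector spaces are over a field $\mathbb{K}$ of characteristic zero; $[n]=\{1,\dots,n\}$; $\mathrm{Vect}(S)$ is the linear span of a set $S$. Operad means nonsymmetric operad in vector spaces, graded by arities $n\ge1$, with partial compositions $\circ_i$ and a unit in arity $1$. $\mathrm{Free}(\mathfrak{G})$ is the free operad on the graded space $\mathfrak{G}$ (spanned by planar rooted trees whose internal nodes of arity $n$ are labeled by elements of $\mathfrak{G}(n)$, with grafting as partial composition); an element of $\mathfrak{G}$ is identified with the corresponding corolla. An operad $\mathcal{O}$ has presentation $(G,\mathfrak{R})$ if $\mathcal{O}\simeq\mathrm{Free}(\mathrm{Vect}(G))/\langle\mathfrak{R}\rangle$, where $\langle\mathfrak{R}\rangle$ is the operad ideal generated by $\mathfrak{R}$. A unitary magma is a set $\mathcal{M}$ with a binary operation $\star$ (not necessarily associative) having a two-sided unit $\mathds{1}_{\mathcal{M}}$. An $\mathcal{M}$-clique $\mathfrak{p}$ of arity $n\ge1$ is a map assigning to every arc $(x,y)$, $1\le x<y\le n+1$, a label $\mathfrak{p}(x,y)\in\mathcal{M}$;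 by convention, the only $\mathcal{M}$-clique of arity $1$ is the one with $\mathfrak{p}(1,2)=\mathds{1}_{\mathcal{M}}$. Put $\mathfrak{p}_0:=\mathfrak{p}(1,n+1)$ (label of the base) and $\mathfrak{p}_i:=\mathfrak{p}(i,i+1)$ for $i\in[n]$ (label of the $i$th edge). For $\mathcal{M}$-cliques $\mathfrak{p},\mathfrak{q}$ of arities $n,m$ and $i\in[n]$, $\mathfrak{p}\circ_i\mathfrak{q}$ is the $\mathcal{M}$-clique of arity $n+m-1$ with $$(\mathfrak{p}\circ_i\mathfrak{q})(x,y)=\begin{cases}\mathfrak{p}(x,y)&\text{if }y\le i,\\ \mathfrak{p}(x,y-m+1)&\text{if }x\le i<i+m\le y,\ (x,y)\ne(i,i+m),\\ \mathfrak{p}(x-m+1,y-m+1)&\text{if }i+m\le x,\\ \mathfrak{q}(x-i+1,y-i+1)&\text{if }i\le x<y\le i+m,\ (x,y)\ne(i,i+m),\\ \mathfrak{p}_i\star\mathfrak{q}_0&\text{if }(x,y)=(i,i+m),\\ \mathds{1}_{\mathcal{M}}&\text{otherwise.}\end{cases}$$ A diagonal is an arc different from $(1,n+1)$ and from all $(x,x+1)$; an arc is solid if its label is not $\mathds{1}_{\mathcal{M}}$; diagonals $(x,y)$, $(x',y')$ are crossing if $x<x'<y<y'$ or $x'<x<y'<y$. An $\mathcal{M}$-clique is noncrossing if no two of its solid diagonals are crossing. $\mathsf{NC}\mathcal{M}$ is the operad spanned by all noncrossing $\mathcal{M}$-cliques, with the partial compositions $(\mathfrak{p},\mathfrak{q})\mapsto\mathfrak{p}\circ_i\mathfrak{q}$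 of $\mathcal{M}$-cliques extended bilinearly and with the unique $\mathcal{M}$-clique of arity $1$ as unit. $\mathcal{T}_{\mathcal{M}}$ is the set of $\mathcal{M}$-triangles, i.e. $\mathcal{M}$-cliques of arity $2$; $T(a;b,c)$ denotes the $\mathcal{M}$-triangle with base label $a$, first edge label $b$ and second edge label $c$. *)

(* Defs.v *)
From HB Require Import structures.
From mathcomp Require Import all_boot all_algebra.
From mathcomp Require Import generic_quotient ring_quotient.
From mathcomp Require Import finmap boolp.
From mathcomp Require Import monalg.
From mathcomp Require Import zify.

Set Implicit Arguments.
Unset Strict Implicit.
Unset Printing Implicit Defensive.

Import GRing.Theory.
Local Open Scope ring_scope.
Local Open Scope quotient_scope.

(* Components are indexed by arity minus one, so that a composition of an
   element of arity n.+1 with one of arity m.+1 has arity (n + m).+1; inputs are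
   numbered from 0. The casts along equalities in nat identify components of
   provably equal arities; inord only retypes an input number which is in
   range. *)
Record operad (K : fieldType) := Operad {
  op_car : nat -> lmodType K;
  op_unit : op_car 0;
  op_comp : forall n m, 'I_n.+1 -> op_car n -> op_car m -> op_car (n + m);
  op_compl : forall n m (i : 'I_n.+1) (y : op_car m),
    linear (fun x : op_car n => op_comp i x y);
  op_compr : forall n m (i : 'I_n.+1) (x : op_car n),
    linear (fun y : op_car m => op_comp i x y);
  op_seqA : forall n m k (i : 'I_n.+1) (j : 'I_m.+1) x y z,
    op_comp (inord (i + j) : 'I_(n + m).+1) (op_comp i x y) z
    = ecast a (op_car a) (addnA n m k) (op_comp i x (op_comp j y z));
  op_parA : forall n m k (i j : 'I_n.+1) x (y : op_car m) (z : op_car k),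
    (i < j)%N ->
    op_comp (inord (j + m) : 'I_(n + m).+1) (op_comp i x y) z
    = ecast a (op_car a) (addnAC n k m)
        (op_comp (inord i : 'I_(n + k).+1) (op_comp j x z) y);
  op_unitl : forall n (x : op_car n), op_comp ord0 op_unit x = x;
  op_unitr : forall n (i : 'I_n.+1) (x : op_car n),
    op_comp i x op_unit = ecast a (op_car a) (esym (addn0 n)) x
}.
Coercion op_car : operad >-> Funclass.
Arguments op_comp {K o n m} i x y.
Arguments op_unit {K} o.

Notation "x \o_( i ) y" := (op_comp i x y)
  (at level 40, left associativity, format "x  \o_( i )  y").

Definition operad_isomorphic (K : fieldType) (O P : operad K) : Prop :=
  exists f : forall n, {linear O n -> P n},
    [/\ forall n, bijective (f n),
        f 0 (op_unit O) = op_unit P &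
        forall n m (i : 'I_n.+1) (x : O n) (y : O m),
          f (n + m)%N (x \o_(i) y) = f n x \o_(i) f m y].

Definition is_subspace (K : fieldType) (V : lmodType K) (W : V -> Prop) :=
  W 0 /\ forall a u v, W u -> W v -> W (a *: u + v).

Definition vect (K : fieldType) (V : lmodType K) (S : V -> Prop) : V -> Prop :=
  fun x => forall W : V -> Prop,
    is_subspace W -> (forall u, S u -> W u) -> W x.

Record operad_ideal (K : fieldType) (O : operad K) := OperadIdeal {
  id_mem : forall n, O n -> Prop;
  id_subspace : forall n, is_subspace (@id_mem n);
  id_compl : forall n m (i : 'I_n.+1) (x : O n) (y : O m),
    id_mem x -> id_mem (x \o_(i) y);
  id_compr : forall n m (i : 'I_n.+1) (x : O n) (y : O m),
    id_mem y -> id_mem (x \o_(i) y)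
}.
Arguments id_mem {K O} o [n].

Section GeneratedIdeal.
Variables (K : fieldType) (O : operad K) (R : forall n, O n -> Prop).

Definition gen_mem n (x : O n) : Prop :=
  forall I : operad_ideal O, (forall k (r : O k), R r -> id_mem I r) -> id_mem I x.

Fact gen_subspace n : is_subspace (@gen_mem n).
Proof.
split=> [I _|a u v Iu Iv I RI]; first exact: (id_subspace I n).1.
exact: ((id_subspace I n).2 a u v (Iu I RI) (Iv I RI)).
Qed.

Fact gen_compl n m (i : 'I_n.+1) (x : O n) (y : O m) :
  gen_mem x -> gen_mem (x \o_(i) y).
Proof. by move=> Ix I RI; apply/id_compl/Ix. Qed.

Fact gen_compr n m (i : 'I_n.+1) (x : O n) (y : O m) :
  gen_mem y -> gen_mem (x \o_(i) y).
Proof. by move=> Iy I RI; apply/id_compr/Iy. Qed.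

Definition generated_ideal : operad_ideal O :=
  OperadIdeal gen_subspace gen_compl gen_compr.
End GeneratedIdeal.

Section QuotientOperad.
Variables (K : fieldType) (O : operad K) (I : operad_ideal O).

Definition ideal_pred n : pred (O n) := fun x => `[< id_mem I x >].

Fact ideal_zmod_closed n : zmod_closed (@ideal_pred n).
Proof.
have [I0 IZ] := id_subspace I n.
split=> [|x y /asboolP Ix /asboolP Iy]; first exact/asboolP.
by apply/asboolP; rewrite -[- y]scaleN1r addrC; apply: IZ.
Qed.

HB.instance Definition _ n :=
  GRing.isZmodClosed.Build (O n) (@ideal_pred n) (@ideal_zmod_closed n).

Definition quo n :=
  Quotient.quot (GRing.ZmodClosed.clone (O n) (@ideal_pred n) _).
HB.instance Definition _ n := GRing.Zmodule.on (quo n).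
HB.instance Definition _ n := EqQuotient.on (quo n).

Lemma quo_ind n (P : quo n -> Prop) :
  (forall x, P (\pi_(quo n) x)) -> forall x, P x.
Proof. by move=> Ppi x; rewrite -[x]reprK. Qed.

Lemma quo_eq n (x y : O n) :
  \pi_(quo n) x = \pi_(quo n) y <-> id_mem I (x - y).
Proof.
split=> [/eqP|Ixy].
  by rewrite -Quotient.idealrBE => /asboolP.
by apply/eqP; rewrite -Quotient.idealrBE; apply/asboolP.
Qed.

Lemma quo_repr n (x : O n) : id_mem I (repr (\pi_(quo n) x) - x).
Proof. by apply/quo_eq; rewrite reprK. Qed.

Lemma id_memZ n a (x : O n) : id_mem I x -> id_mem I (a *: x).
Proof.
have [I0 IZ] := id_subspace I n.
by move=> Ix; rewrite -[_ *: _]addr0; apply: IZ.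
Qed.

Lemma id_memD n (x y : O n) : id_mem I x -> id_mem I y -> id_mem I (x + y).
Proof.
have [I0 IZ] := id_subspace I n.
by move=> Ix Iy; rewrite -[x]scale1r; apply: IZ.
Qed.

Definition quo_scale n (a : K) (x : quo n) : quo n := \pi_(quo n) (a *: repr x).

Lemma quo_scaleE n a (x : O n) :
  quo_scale a (\pi_(quo n) x) = \pi_(quo n) (a *: x).
Proof. by apply/quo_eq; rewrite -scalerBr; apply/id_memZ/quo_repr. Qed.

Lemma pi_quoD n (x y : O n) :
  \pi_(quo n) (x + y) = \pi_(quo n) x + \pi_(quo n) y.
Proof. by rewrite !piE. Qed.

Fact quo_scaleA n a b (x : quo n) :
  quo_scale a (quo_scale b x) = quo_scale (a * b) x.
Proof. by elim/quo_ind: x => x; rewrite !quo_scaleE scalerA. Qed.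

Fact quo_scale1 n : left_id 1 (@quo_scale n).
Proof. by elim/quo_ind=> x; rewrite quo_scaleE scale1r. Qed.

Fact quo_scaleDr n : right_distributive (@quo_scale n) +%R.
Proof.
move=> a; elim/quo_ind=> x; elim/quo_ind=> y.
by rewrite -pi_quoD !quo_scaleE scalerDr pi_quoD.
Qed.

Fact quo_scaleDl n (x : quo n) :
  {morph (@quo_scale n)^~ x : a b / a + b}.
Proof.
by move=> a b; elim/quo_ind: x => x; rewrite !quo_scaleE scalerDl pi_quoD.
Qed.

HB.instance Definition _ n := GRing.Zmodule_isLmodule.Build K (quo n)
  (@quo_scaleA n) (@quo_scale1 n) (@quo_scaleDr n) (@quo_scaleDl n).

Lemma pi_quoZ n a (x : O n) : \pi_(quo n) (a *: x) = a *: \pi_(quo n) x.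
Proof. by rewrite -quo_scaleE. Qed.

Definition quo_comp n m (i : 'I_n.+1) (x : quo n) (y : quo m) : quo (n + m) :=
  \pi_(quo (n + m)) (repr x \o_(i) repr y).

Lemma op_compBl n m (i : 'I_n.+1) (x x' : O n) (y : O m) :
  (x - x') \o_(i) y = x \o_(i) y - x' \o_(i) y.
Proof.
by rewrite addrC -scaleN1r op_compl scaleN1r addrC.
Qed.

Lemma op_compBr n m (i : 'I_n.+1) (x : O n) (y y' : O m) :
  x \o_(i) (y - y') = x \o_(i) y - x \o_(i) y'.
Proof.
by rewrite addrC -scaleN1r op_compr scaleN1r addrC.
Qed.

Lemma quo_compE n m (i : 'I_n.+1) (x : O n) (y : O m) :
  quo_comp i (\pi_(quo n) x) (\pi_(quo m) y) = \pi_(quo (n + m)) (x \o_(i) y).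
Proof.
apply/quo_eq; set x' := repr _; set y' := repr _.
have -> : x' \o_(i) y' - x \o_(i) y
        = (x' - x) \o_(i) y' + x \o_(i) (y' - y).
  by rewrite op_compBl op_compBr addrA subrK.
by apply: id_memD; [apply: id_compl | apply: id_compr]; apply: quo_repr.
Qed.

Lemma pi_quo_cast n m (e : n = m) (x : O n) :
  \pi_(quo m) (ecast a (O a) e x) = ecast a (quo a) e (\pi_(quo n) x).
Proof. by case: _ / e. Qed.

Fact quo_compl n m (i : 'I_n.+1) (y : quo m) :
  linear (fun x : quo n => quo_comp i x y).
Proof.
move=> a; elim/quo_ind=> u; elim/quo_ind=> v; elim/quo_ind: y => y.
by rewrite -pi_quoZ -pi_quoD !quo_compE op_compl pi_quoD pi_quoZ.
Qed.

Fact quo_compr n m (i : 'I_n.+1) (x : quo n) :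
  linear (fun y : quo m => quo_comp i x y).
Proof.
move=> a; elim/quo_ind=> u; elim/quo_ind=> v; elim/quo_ind: x => x.
by rewrite -pi_quoZ -pi_quoD !quo_compE op_compr pi_quoD pi_quoZ.
Qed.

Fact quo_seqA n m k (i : 'I_n.+1) (j : 'I_m.+1) x y z :
  quo_comp (inord (i + j) : 'I_(n + m).+1) (quo_comp i x y) z
  = ecast a (quo a) (addnA n m k) (quo_comp i x (quo_comp j y z)).
Proof.
elim/quo_ind: x => x; elim/quo_ind: y => y; elim/quo_ind: z => z.
by rewrite !quo_compE op_seqA pi_quo_cast.
Qed.

Fact quo_parA n m k (i j : 'I_n.+1) x (y : quo m) (z : quo k) :
  (i < j)%N ->
  quo_comp (inord (j + m) : 'I_(n + m).+1) (quo_comp i x y) z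
  = ecast a (quo a) (addnAC n k m)
      (quo_comp (inord i : 'I_(n + k).+1) (quo_comp j x z) y).
Proof.
move=> ltij; elim/quo_ind: x => x; elim/quo_ind: y => y; elim/quo_ind: z => z.
by rewrite !quo_compE op_parA // pi_quo_cast.
Qed.

Fact quo_unitl n (x : quo n) : quo_comp ord0 (\pi_(quo 0) (op_unit O)) x = x.
Proof. by elim/quo_ind: x => x; rewrite quo_compE op_unitl. Qed.

Fact quo_unitr n (i : 'I_n.+1) (x : quo n) :
  quo_comp i x (\pi_(quo 0) (op_unit O))
  = ecast a (quo a) (esym (addn0 n)) x.
Proof. by elim/quo_ind: x => x; rewrite quo_compE op_unitr pi_quo_cast. Qed.

Definition quotient_operad : operad K :=
  @Operad K quo _ quo_comp quo_compl quo_compr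
    quo_seqA quo_parA quo_unitl quo_unitr.
End QuotientOperad.

Record set_operad := SetOperad {
  so_car : nat -> choiceType;
  so_unit : so_car 0;
  so_comp : forall n m, 'I_n.+1 -> so_car n -> so_car m -> so_car (n + m);
  so_seqA : forall n m k (i : 'I_n.+1) (j : 'I_m.+1) x y z,
    so_comp (inord (i + j) : 'I_(n + m).+1) (so_comp i x y) z
    = ecast a (so_car a) (addnA n m k) (so_comp i x (so_comp j y z));
  so_parA : forall n m k (i j : 'I_n.+1) x (y : so_car m) (z : so_car k),
    (i < j)%N ->
    so_comp (inord (j + m) : 'I_(n + m).+1) (so_comp i x y) z
    = ecast a (so_car a) (addnAC n k m)
        (so_comp (inord i : 'I_(n + k).+1) (so_comp j x z) y);
  so_unitl : forall n (x : so_car n), so_comp ord0 so_unit x = x;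
  so_unitr : forall n (i : 'I_n.+1) (x : so_car n),
    so_comp i x so_unit = ecast a (so_car a) (esym (addn0 n)) x
}.
Coercion so_car : set_operad >-> Funclass.
Arguments so_comp {s n m} i x y.
Arguments so_unit s : clear implicits.

Section LinearExtension.
Variables (K : fieldType) (S : choiceType) (V : lmodType K).

Definition lext (f : S -> V) (x : {malg K[S]}) : V :=
  \sum_(s <- msupp x) x@_s *: f s.

Lemma lextEw f (x : {malg K[S]}) (D : {fset S}) :
  (msupp x `<=` D)%fset -> lext f x = \sum_(s <- D) x@_s *: f s.
Proof.
move=> sD; apply: big_fset_incl => // s _ /mcoeff_outdom ->.
by rewrite scale0r.
Qed.

Fact lext_is_linear f : linear (lext f).
Proof.
move=> a x y.
rewrite (@lextEw _ (a *: x + y) (msupp x `|` msupp y)%fset); last first.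
  apply: (fsubset_trans (msuppD_le _ _)).
  by apply: fsetUSS => //; apply: msuppZ_le.
rewrite (lextEw _ (fsubsetUl (msupp x) (msupp y))).
rewrite (lextEw _ (fsubsetUr (msupp x) (msupp y))).
rewrite scaler_sumr -big_split /=; apply: eq_bigr => s _.
by rewrite mcoeffD mcoeffZ scalerDl scalerA.
Qed.

HB.instance Definition _ f :=
  GRing.isLinear.Build K {malg K[S]} V _ (lext f) (@lext_is_linear f).

Lemma lextU f s : lext f << s >> = f s.
Proof.
rewrite (@lextEw _ _ [fset s]%fset) ?msuppU_le //.
by rewrite big_seq_fset1 mcoeffUU scale1r.
Qed.

Lemma eq_lext f g : f =1 g -> lext f =1 lext g.
Proof. by move=> fg x; apply: eq_bigr => s _; rewrite fg. Qed.

Lemma malg_lin_ext (f g : {linear {malg K[S]} -> V}) :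
  (forall s, f << s >> = g << s >>) -> f =1 g.
Proof.
move=> fg x; rewrite [x]monalgE !raddf_sum /=; apply: eq_bigr => s _.
have -> : << x@_s *g s >> = x@_s *: << s >> :> {malg K[S]}.
  by apply/malgP => k; rewrite mcoeffZ !mcoeffU mulrnAr mulr1.
by rewrite !linearZ /= fg.
Qed.
End LinearExtension.

Section LinearOperad.
Variables (K : fieldType) (S : set_operad).

Definition lin_car n : lmodType K := {malg K[S n]}.

Definition lin_comp n m (i : 'I_n.+1) (x : lin_car n) (y : lin_car m) :
    lin_car (n + m) :=
  lext (fun s : S n => lext (fun t : S m => << so_comp i s t >>) y) x.

Fact lin_compl n m (i : 'I_n.+1) (y : lin_car m) :
  linear (fun x : lin_car n => lin_comp i x y).
Proof. by move=> a u v; rewrite /lin_comp linearP. Qed.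

Fact lin_compr n m (i : 'I_n.+1) (x : lin_car n) :
  linear (fun y : lin_car m => lin_comp i x y).
Proof.
move=> a u v; rewrite /lin_comp /lext scaler_sumr -big_split /=.
apply: eq_bigr => s _; rewrite -!/(lext _ _) linearP scalerDr.
by rewrite !scalerA mulrC.
Qed.

Lemma lin_compU n m (i : 'I_n.+1) (s : S n) (t : S m) :
  lin_comp i << s >> << t >> = << so_comp i s t >>.
Proof. by rewrite /lin_comp !lextU. Qed.

Lemma malg_cast n m (e : n = m) (s : S n) :
  << ecast a (S a) e s >> = ecast a (lin_car a) e << s >>.
Proof. by case: _ / e. Qed.

Lemma lin_cast_linear n m (e : n = m) :
  linear (fun x : lin_car n => ecast a (lin_car a) e x).
Proof. by case: _ / e. Qed.

Lemma lin_ext n (V : lmodType K) (f g : lin_car n -> V) :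
  linear f -> linear g -> (forall s, f << s >> = g << s >>) -> f =1 g.
Proof.
move=> lf lg; pose F : {linear _ -> _} := HB.pack f (GRing.isLinear.Build _ _ _ _ f lf).
pose G : {linear _ -> _} := HB.pack g (GRing.isLinear.Build _ _ _ _ g lg).
exact: (@malg_lin_ext _ _ _ F G).
Qed.

Fact lin_seqA n m k (i : 'I_n.+1) (j : 'I_m.+1) x y z :
  lin_comp (inord (i + j) : 'I_(n + m).+1) (lin_comp i x y) z
  = ecast a (lin_car a) (addnA n m k) (lin_comp i x (lin_comp j y z)).
Proof.
move: x; apply: lin_ext => [a u v|a u v|s]; first by rewrite !lin_compl.
  by rewrite lin_compl lin_cast_linear.
move: y; apply: lin_ext => [a u v|a u v|t].
- by rewrite lin_compr lin_compl.
- by rewrite lin_compl lin_compr lin_cast_linear.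
move: z; apply: lin_ext => [a u v|a u v|r].
- by rewrite lin_compr.
- by rewrite !lin_compr lin_cast_linear.
by rewrite !lin_compU so_seqA malg_cast.
Qed.

Fact lin_parA n m k (i j : 'I_n.+1) x (y : lin_car m) (z : lin_car k) :
  (i < j)%N ->
  lin_comp (inord (j + m) : 'I_(n + m).+1) (lin_comp i x y) z
  = ecast a (lin_car a) (addnAC n k m)
      (lin_comp (inord i : 'I_(n + k).+1) (lin_comp j x z) y).
Proof.
move=> ltij.
move: x; apply: lin_ext => [a u v|a u v|s]; first by rewrite !lin_compl.
  by rewrite !lin_compl lin_cast_linear.
move: y; apply: lin_ext => [a u v|a u v|t].
- by rewrite lin_compr lin_compl.
- by rewrite lin_compr lin_cast_linear.
move: z; apply: lin_ext => [a u v|a u v|r].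
- by rewrite lin_compr.
- by rewrite lin_compr lin_compl lin_cast_linear.
by rewrite !lin_compU so_parA // malg_cast.
Qed.

Fact lin_unitl n (x : lin_car n) : lin_comp ord0 << so_unit S >> x = x.
Proof.
move: x; apply: lin_ext => [a u v|a u v|s] //; first by rewrite lin_compr.
by rewrite lin_compU so_unitl.
Qed.

Fact lin_unitr n (i : 'I_n.+1) (x : lin_car n) :
  lin_comp i x << so_unit S >> = ecast a (lin_car a) (esym (addn0 n)) x.
Proof.
move: x; apply: lin_ext => [a u v|a u v|s]; first by rewrite lin_compl.
  by rewrite lin_cast_linear.
by rewrite lin_compU so_unitr malg_cast.
Qed.

Definition linear_operad : operad K :=
  @Operad K lin_car _ lin_comp lin_compl lin_compr
    lin_seqA lin_parA lin_unitl lin_unitr.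
End LinearOperad.

(* Planar rooted trees with internal nodes labeled by G; a label in G n is meant
   for nodes with n.+1 children. *)
Inductive ptree (G : nat -> choiceType) : Type :=
| Leaf
| Node n (g : G n) (ts : seq (ptree G)).
Arguments Leaf {G}.

Section PlanarTrees.
Variable G : nat -> choiceType.
Implicit Types (t s r : ptree G) (ts : seq (ptree G)).

Lemma ptree_ind' (P : ptree G -> Prop) :
  P Leaf ->
  (forall n (g : G n) ts, (forall t, List.In t ts -> P t) -> P (Node g ts)) ->
  forall t, P t.
Proof.
move=> PL PN; fix IH 1 => -[|n g ts]; first exact: PL.
apply: PN; elim: ts => [t' []|t ts IHts t' [<-|]]; first exact: IH.
exact: IHts.
Qed.

Fixpoint ptree_enc t : GenTree.tree {n & G n} :=
  match t with
  | Leaf => GenTree.Node 0 [::]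
  | Node n g ts => GenTree.Node 1 (GenTree.Leaf (existT _ n g) :: map ptree_enc ts)
  end.

Fixpoint ptree_dec (u : GenTree.tree {n & G n}) : ptree G :=
  match u with
  | GenTree.Node 1 (GenTree.Leaf (existT n g) :: us) =>
      Node g (map ptree_dec us)
  | _ => Leaf
  end.

Fact ptree_encK : cancel ptree_enc ptree_dec.
Proof.
elim/ptree_ind' => [|n g ts IH] //=; congr Node.
elim: ts IH => //= t ts IHts IH; rewrite IH; last by left.
by rewrite IHts // => u uts; apply: IH; right.
Qed.

HB.instance Definition _ := Choice.copy (ptree G) (can_type ptree_encK).

Fixpoint leaves t : nat :=
  if t is Node _ _ ts then sumn (map leaves ts) else 1%N.

Fixpoint wf t : bool :=
  if t is Node n _ ts then (size ts == n.+1) && all wf ts else true.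

(* The tree obtained from t by replacing its i-th leaf, from left to right and
   numbered from 0, by s. *)
Fixpoint graft s (i : nat) t : ptree G :=
  match t with
  | Leaf => s
  | Node n g ts =>
      Node g ((fix grafts (i : nat) ts :=
        match ts with
        | [::] => [::]
        | t' :: ts' =>
            if (i < leaves t')%N then graft s i t' :: ts'
            else t' :: grafts (i - leaves t')%N ts'
        end) i ts)
  end.

Definition grafts s := fix grafts (i : nat) ts : seq (ptree G) :=
  match ts with
  | [::] => [::]
  | t' :: ts' =>
      if (i < leaves t')%N then graft s i t' :: ts'
      else t' :: grafts (i - leaves t')%N ts'
  end.

Lemma graft_Node s i n (g : G n) ts : graft s i (Node g ts) = Node g (grafts s i ts).
Proof. by []. Qed.

Lemma size_grafts s i ts : size (grafts s i ts) = size ts.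
Proof. by elim: ts i => //= t ts IH i; case: ifP => //= _; rewrite IH. Qed.

Lemma leaves_graft s i t :
  (i < leaves t)%N -> (leaves (graft s i t)).+1 = (leaves t + leaves s)%N.
Proof.
elim/ptree_ind': t i => [|n g ts IH] i; first by rewrite /=; lia.
rewrite graft_Node /=; elim: ts i IH => //= t ts IHts i IH.
case: ifP => /= [lti _|gei lti].
  by have := IH t (or_introl erefl) i lti; lia.
have /IHts : (i - leaves t < sumn (map leaves ts))%N by lia.
by move=> /(_ (fun u uts => IH u (or_intror uts))); lia.
Qed.

Lemma wf_graft s i t : wf s -> wf t -> wf (graft s i t).
Proof.
move=> ws; elim/ptree_ind': t i => [|n g ts IH] i //.
rewrite graft_Node /= size_grafts => /andP[-> /=].
elim: ts i IH => //= t ts IHts i IH /andP[wt wts].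
case: ifP => /= _; first by rewrite IH //; left.
by rewrite wt IHts // => u uts; apply: IH; right.
Qed.

Lemma graft_seqA r s t i j : (i < leaves t)%N -> (j < leaves s)%N ->
  graft r (i + j) (graft s i t) = graft (graft r j s) i t.
Proof.
move=> + ltj; elim/ptree_ind': t i => [|n g ts IH] i.
  by rewrite /= ltnS leqn0 => /eqP->.
rewrite !graft_Node /= => lti; congr Node.
elim: ts i IH lti => //= t ts IHts i IH lti.
case: ifP => /= [lti'|gei].
  have e := leaves_graft s lti'.
  by rewrite ifT ?IH //; [left | lia].
rewrite ifF; last lia.
rewrite (_ : i + j - leaves t = i - leaves t + j)%N; last lia.
by rewrite IHts //; [move=> u uts; apply: IH; right | lia].
Qed.

Lemma graft_parA r s t i j : (i < j)%N -> (j < leaves t)%N ->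
  graft r (j + leaves s).-1 (graft s i t) = graft s i (graft r j t).
Proof.
elim/ptree_ind': t i j => [|n g ts IH] i j; first by rewrite /=; lia.
rewrite !graft_Node /= => ltij ltj; congr Node.
elim: ts i j IH ltij ltj => //= t ts IHts i j IH ltij ltj.
case: (ltnP j (leaves t)) => ltj' /=.
  rewrite ifT /=; last lia.
  have e := leaves_graft s (ltn_trans ltij ltj').
  have e' := leaves_graft r ltj'.
  have i_lt : (i < leaves t)%N by lia.
  have [r0|r0] := posnP (leaves r).
    case: (ltnP i (leaves (graft r j t))) => h; last lia.
    rewrite ifT; last lia.
    by rewrite IH //; left.
  by rewrite !ifT ?IH //; [left|lia|lia].
case: (ltnP i (leaves t)) => lti /=.
  have e := leaves_graft s lti.
  rewrite ifF; last lia.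
  by congr (_ :: grafts _ _ _); lia.
rewrite ifF; last lia.
rewrite -IHts; [|by move=> u uts; apply: IH; right|lia|lia].
by congr (_ :: grafts _ _ _); lia.
Qed.

Lemma graft_leaf i t : graft Leaf i t = t.
Proof.
elim/ptree_ind': t i => [|n g ts IH] i //; rewrite graft_Node; congr Node.
elim: ts i IH => //= t ts IHts i IH.
case: ifP => _; first by rewrite IH //; left.
by rewrite IHts // => u uts; apply: IH; right.
Qed.

Definition tree n := {t : ptree G | wf t && (leaves t == n.+1)}.

Lemma val_tree_cast n m (e : n = m) (t : tree n) :
  val (ecast a (tree a) e t) = val t.
Proof. by case: _ / e. Qed.

Lemma leaves_tree n (t : tree n) : leaves (val t) = n.+1.
Proof. by have /andP[_ /eqP] := valP t. Qed.

Definition tree_unit : tree 0 := exist _ Leaf isT.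

Fact tree_comp_subproof n m (i : 'I_n.+1) (t : tree n) (s : tree m) :
  let u := graft (val s) i (val t) in wf u && (leaves u == (n + m).+1).
Proof.
have /andP[wt _] := valP t; have /andP[ws _] := valP s.
rewrite /= wf_graft //=.
have lti : (i < leaves (val t))%N by rewrite leaves_tree.
by have := leaves_graft (val s) lti; rewrite !leaves_tree /=; lia.
Qed.

Definition tree_comp n m (i : 'I_n.+1) (t : tree n) (s : tree m) : tree (n + m) :=
  exist _ (graft (val s) i (val t)) (tree_comp_subproof i t s).

Fact tree_seqA n m k (i : 'I_n.+1) (j : 'I_m.+1) x y z :
  tree_comp (inord (i + j) : 'I_(n + m).+1) (tree_comp i x y) z
  = ecast a (tree a) (addnA n m k) (tree_comp i x (tree_comp j y z)).
Proof.
apply: val_inj; rewrite val_tree_cast /= inordK; last first.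
  by have := ltn_ord i; have := ltn_ord j; lia.
by apply: graft_seqA; rewrite leaves_tree.
Qed.

Fact tree_parA n m k (i j : 'I_n.+1) x (y : tree m) (z : tree k) :
  (i < j)%N ->
  tree_comp (inord (j + m) : 'I_(n + m).+1) (tree_comp i x y) z
  = ecast a (tree a) (addnAC n k m)
      (tree_comp (inord i : 'I_(n + k).+1) (tree_comp j x z) y).
Proof.
have := ltn_ord j => ltj ltij.
apply: val_inj; rewrite val_tree_cast /= !inordK; [|lia|lia].
rewrite -[RHS]graft_parA ?leaves_tree //.
by congr (graft _ _ _); rewrite addnS.
Qed.

Fact tree_unitl n (x : tree n) : tree_comp ord0 tree_unit x = x.
Proof. exact: val_inj. Qed.

Fact tree_unitr n (i : 'I_n.+1) (x : tree n) :
  tree_comp i x tree_unit = ecast a (tree a) (esym (addn0 n)) x.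
Proof. by apply: val_inj; rewrite val_tree_cast /= graft_leaf. Qed.

Definition tree_operad : set_operad :=
  @SetOperad (fun n => tree n) tree_unit tree_comp
    tree_seqA tree_parA tree_unitl tree_unitr.

Fact corolla_subproof n (g : G n) :
  let u := Node g (nseq n.+1 Leaf) in wf u && (leaves u == n.+1).
Proof.
rewrite /= size_nseq eqxx all_nseq orbT map_nseq sumn_nseq mul1n.
by rewrite add1n eqxx.
Qed.

Definition corolla_tree n (g : G n) : tree_operad n :=
  exist _ (Node g (nseq n.+1 Leaf)) (corolla_subproof g).
End PlanarTrees.

(* By multilinearity of the labels, the trees whose nodes are labeled by elements
   of G form a basis of the free operad on the graded space Vect(G). *)
Definition free_operad (K : fieldType) (G : nat -> choiceType) : operad K :=
  linear_operad K (tree_operad G).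

Definition corolla (K : fieldType) (G : nat -> choiceType) n (g : G n) :
    free_operad K G n :=
  << corolla_tree g >>.

Definition has_presentation (K : fieldType) (O : operad K)
    (G : nat -> choiceType) (R : forall n, free_operad K G n -> Prop) : Prop :=
  operad_isomorphic O (quotient_operad (generated_ideal R)).

(* The graded subset equal to S in degree k and empty in the other degrees. *)
Inductive in_degree (V : nat -> Type) k (S : V k -> Prop) :
    forall n, V n -> Prop :=
| InDegree x of S x : @in_degree V k S k x.

#[short(type="finUMagmaType")]
HB.structure Definition FinUMagma := {M of UMagma M & Finite M}.

Section Cliques.
Variable M : umagmaType.

(* The vertices of a clique of arity n.+1 are numbered from 0 to n.+1. *)
Definition arc n := {a : 'I_n.+2 * 'I_n.+2 | (a.1 < a.2)%N}.

Definition clique n :=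
  {p : {ffun arc n -> M} | (n == 0)%N ==> [forall a, p a == 1%g]}.

(* By convention, the label of a pair which is not an arc is the unit. *)
Definition label n (p : clique n) (x y : nat) : M :=
  if [pick a : arc n | ((val a).1 == x :> nat) && ((val a).2 == y :> nat)] is Some a
  then val p a else 1%g.

Definition base n (p : clique n) : M := label p 0 n.+1.
Definition edge n (p : clique n) (i : nat) : M := label p i i.+1.

(* As q has arity m.+1, it is inserted on the arc (i, i + m.+1), and the vertices
   of p lying beyond it are shifted by m. *)
Definition comp_label n m (p : clique n) (q : clique m) (i x y : nat) : M :=
  if (x == i) && (y == i + m.+1)%N then (edge p i * base q)%g
  else if (y <= i)%N then label p x y
  else if (x <= i)%N && (i + m.+1 <= y)%N then label p x (y - m)
  else if (i + m.+1 <= x)%N then label p (x - m) (y - m)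
  else if [&& i <= x, x < y & y <= i + m.+1]%N then label q (x - i) (y - i)
  else 1%g.

Lemma labelE n (p : clique n) (a : arc n) :
  label p (val a).1 (val a).2 = val p a.
Proof.
rewrite /label; case: pickP => [b /andP[/eqP e1 /eqP e2]|/(_ a)]; last first.
  by rewrite !eqxx.
congr (val p _); apply: val_inj.
by case: (val a) (val b) e1 e2 => [a1 a2] [b1 b2] /= /val_inj-> /val_inj->.
Qed.

Lemma label_out n (p : clique n) x y :
  ~~ ((x < y)%N && (y <= n.+1)%N) -> label p x y = 1%g.
Proof.
rewrite /label; case: pickP => [b /andP[/eqP e1 /eqP e2]|//].
have := valP b; rewrite -e1 -e2 /= => ->.
by rewrite -ltnS ltn_ord.
Qed.

Lemma arcP n x y : (x < y)%N -> (y <= n.+1)%N ->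
  exists a : arc n, ((val a).1 = x :> nat) /\ ((val a).2 = y :> nat).
Proof.
move=> ltxy ley; have ltx : (x < n.+2)%N by lia.
have lty : (y < n.+2)%N by lia.
by exists (exist _ (Ordinal ltx, Ordinal lty) ltxy).
Qed.

Lemma clique_eq n (p q : clique n) :
  (forall x y, (x < y)%N -> (y <= n.+1)%N -> label p x y = label q x y) -> p = q.
Proof.
move=> epq; apply: val_inj; apply/ffunP => a; rewrite -!labelE; apply: epq.
  exact: (valP a).
by rewrite -ltnS ltn_ord.
Qed.

Lemma label0 (p : clique 0) x y : label p x y = 1%g.
Proof.
rewrite /label; case: pickP => // a _.
by have /= /forallP/(_ a)/eqP := valP p.
Qed.

Fact comp_subproof n m (i : 'I_n.+1) (p : clique n) (q : clique m) :
  ((n + m)%N == 0)%N ==>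
  [forall a, [ffun a : arc (n + m) =>
                comp_label p q i (val a).1 (val a).2] a == 1%g].
Proof.
apply/implyP; rewrite addn_eq0 => /andP[/eqP n0 /eqP m0].
apply/forallP => a; rewrite ffunE; subst n m.
by rewrite /comp_label /edge /base !label0 mul1g !if_same.
Qed.

Definition clique_comp n m (i : 'I_n.+1) (p : clique n) (q : clique m) :
    clique (n + m) :=
  exist _ [ffun a : arc (n + m) => comp_label p q i (val a).1 (val a).2]
    (comp_subproof i p q).

Fact unit_subproof :
  (0 == 0)%N ==> [forall a, [ffun a : arc 0 => 1%g : M] a == 1%g].
Proof. by apply/forallP => a; rewrite ffunE. Qed.

Definition clique_unit : clique 0 :=
  exist _ [ffun a : arc 0 => 1%g] unit_subproof.

Lemma label_comp n m (i : 'I_n.+1) (p : clique n) (q : clique m) x y :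
  (x < y)%N -> (y <= (n + m).+1)%N ->
  label (clique_comp i p q) x y = comp_label p q i x y.
Proof.
move=> ltxy ley; have [a [<- <-]] := @arcP (n + m) x y ltxy ley.
by rewrite labelE ffunE.
Qed.

Definition is_diagonal n (a : arc n) : bool :=
  (((val a).1 : nat, (val a).2 : nat) != (0, n.+1)%N)
  && ((val a).2 != (val a).1.+1 :> nat).

Definition is_solid n (p : clique n) (a : arc n) : bool := val p a != 1%g.

Definition crossing n (a b : arc n) : bool :=
  [&& (val a).1 < (val b).1, (val b).1 < (val a).2 & (val a).2 < (val b).2]%N
  || [&& (val b).1 < (val a).1, (val a).1 < (val b).2 & (val b).2 < (val a).2]%N.

Definition noncrossing n (p : clique n) : bool :=
  [forall a : arc n, forall b : arc n,
     [&& is_diagonal a, is_diagonal b, is_solid p a & is_solid p b]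
     ==> ~~ crossing a b].

Definition ncclique n := {p : clique n | noncrossing p}.

Lemma noncrossingP n (p : clique n) :
  reflect (forall x x' y y', (x < x')%N -> (x' < y)%N -> (y < y')%N ->
             label p x y != 1%g -> label p x' y' = 1%g)
          (noncrossing p).
Proof.
have bnd (a : arc n) : ((val a).1 < (val a).2)%N && ((val a).2 <= n.+1)%N.
  by rewrite (valP a) -ltnS ltn_ord.
apply: (iffP forallP) => [nc x x' y y' h1 h2 h3 sx | H a]; last first.
  apply/forallP=> b; apply/implyP => /and4P[_ _ sa sb].
  apply/negP => /orP[] /and3P[h1 h2 h3].
    by move: sb; rewrite /is_solid -labelE (H _ _ _ _ h1 h2 h3) ?labelE ?eqxx.
  by move: sa; rewrite /is_solid -labelE (H _ _ _ _ h1 h2 h3) ?labelE ?eqxx.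
apply/eqP/negPn/negP => sy.
have ly' : (y' <= n.+1)%N.
  by apply: contraNT sy => ?; apply/eqP/label_out; lia.
have [a [a1 a2]] : exists a : arc n, _ := @arcP n x y ltac:(lia) ltac:(lia).
have [b [b1 b2]] : exists a : arc n, _ := @arcP n x' y' ltac:(lia) ltac:(lia).
have /forallP/(_ b)/implyP := nc a.
rewrite /is_diagonal /is_solid -!labelE /crossing a1 a2 b1 b2 sx sy !andbT.
rewrite h1 h2 h3 /= xpair_eqE => /(_ _) H; suff: false by []; apply: H.
by rewrite !xpair_eqE; lia.
Qed.

Lemma label_cast n m (e : n = m) (p : clique n) x y :
  label (ecast a (clique a) e p) x y = label p x y.
Proof. by case: _ / e. Qed.

Variant comp_label_spec n m (p : clique n) (q : clique m) (i x y : nat) :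
    M -> Prop :=
| CompEdge of x = i & y = (i + m.+1)%N :
    comp_label_spec p q i x y (label p i i.+1 * label q 0 m.+1)%g
| CompLeft of (y <= i)%N : comp_label_spec p q i x y (label p x y)
| CompOver1 of (x < i)%N & (i + m.+1 <= y)%N :
    comp_label_spec p q i x y (label p x (y - m))
| CompOver2 of x = i & (i + m.+1 < y)%N :
    comp_label_spec p q i x y (label p x (y - m))
| CompRight of (i + m.+1 <= x)%N :
    comp_label_spec p q i x y (label p (x - m) (y - m))
| CompIn1 of x = i & (y < i + m.+1)%N :
    comp_label_spec p q i x y (label q (x - i) (y - i))
| CompIn2 of (i < x)%N & (y <= i + m.+1)%N :
    comp_label_spec p q i x y (label q (x - i) (y - i))
| CompCrossL of (x < i)%N & (i < y)%N & (y < i + m.+1)%N :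
    comp_label_spec p q i x y 1%g
| CompCrossR of (i < x)%N & (x < i + m.+1)%N & (i + m.+1 < y)%N :
    comp_label_spec p q i x y 1%g.

Lemma comp_labelP n m (p : clique n) (q : clique m) i x y : (x < y)%N ->
  comp_label_spec p q i x y (comp_label p q i x y).
Proof.
move=> ltxy; rewrite /comp_label /edge /base.
have [/andP[/eqP xi /eqP yi]|ne] := ifP; first by rewrite xi; apply: CompEdge; lia.
have [le|gt] := leqP y i; first exact: CompLeft.
have [/andP[h1 h2]|h] := ifP.
  by have [lt|ge] := ltnP x i; [apply: CompOver1|apply: CompOver2]; lia.
have [le|gt'] := leqP (i + m.+1) x; first exact: CompRight.
have [/and3P[h1 h2 h3]|h'] := ifP.
  by have [lt|ge] := ltnP i x; [apply: CompIn2|apply: CompIn1]; lia.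
have [lt|ge] := ltnP x i; first by apply: CompCrossL; lia.
by apply: CompCrossR; lia.
Qed.

Local Ltac label_eq :=
  match goal with
  | |- ?u = ?u => reflexivity
  | |- label ?p _ _ = label ?p _ _ => congr (label p _ _); lia
  | |- (label ?p _ _ * ?u)%g = (label ?p _ _ * ?u)%g =>
      congr (label p _ _ * u)%g; lia
  | |- (?u * label ?p _ _)%g = (?u * label ?p _ _)%g =>
      congr (u * label p _ _)%g; lia
  end.

Fact clique_seqA n m k (i : 'I_n.+1) (j : 'I_m.+1)
    (p : clique n) (q : clique m) (r : clique k) :
  clique_comp (inord (i + j) : 'I_(n + m).+1) (clique_comp i p q) r
  = ecast a (clique a) (addnA n m k) (clique_comp i p (clique_comp j q r)).
Proof.
have lti := ltn_ord i; have ltj := ltn_ord j.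
apply: clique_eq => x y ltxy ley.
rewrite label_cast !label_comp ?inordK //; try lia.
case: comp_labelP => // *; case: comp_labelP => // *; try (exfalso; lia);
  rewrite ?label_comp; try lia; try label_eq.
all: repeat ((case: comp_labelP; first lia); move=> *; try (exfalso; lia)); try label_eq.
have m0 : m = 0%N by lia.
by clear -m0; subst m; rewrite !label0 mulg1 mul1g.
Qed.

Fact clique_parA n m k (i j : 'I_n.+1)
    (p : clique n) (q : clique m) (r : clique k) :
  (i < j)%N ->
  clique_comp (inord (j + m) : 'I_(n + m).+1) (clique_comp i p q) r
  = ecast a (clique a) (addnAC n k m)
      (clique_comp (inord i : 'I_(n + k).+1) (clique_comp j p r) q).
Proof.
have lti := ltn_ord i; have ltj := ltn_ord j => ltij.
apply: clique_eq => x y ltxy ley.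
rewrite label_cast !label_comp ?inordK //; try lia.
case: comp_labelP => // *; case: comp_labelP => // *; try (exfalso; lia);
  rewrite ?label_comp; try lia; try label_eq.
all: repeat ((case: comp_labelP; first lia); move=> *; try (exfalso; lia)); try label_eq.
Qed.

Fact clique_unitl n (p : clique n) : clique_comp ord0 clique_unit p = p.
Proof.
apply: clique_eq => x y ltxy ley; rewrite label_comp //.
rewrite (_ : nat_of_ord ord0 = 0%N) //.
case: comp_labelP => // *; rewrite ?label0 ?mul1g; try (exfalso; lia); try label_eq.
Qed.

Fact clique_unitr n (i : 'I_n.+1) (p : clique n) :
  clique_comp i p clique_unit = ecast a (clique a) (esym (addn0 n)) p.
Proof.
have lti := ltn_ord i.
apply: clique_eq => x y ltxy ley; rewrite label_cast label_comp //.
case: comp_labelP => // *; rewrite ?label0 ?mulg1; try (exfalso; lia); try label_eq.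
Qed.

Fact noncrossing_comp n m (i : 'I_n.+1) (p : clique n) (q : clique m) :
  noncrossing p -> noncrossing q -> noncrossing (clique_comp i p q).
Proof.
have lti := ltn_ord i.
move=> /noncrossingP ncp /noncrossingP ncq.
apply/noncrossingP => x x' y y' h1 h2 h3.
have [ley'|gty'] := leqP y' (n + m).+1; last first.
  by move=> _; apply: label_out; lia.
rewrite !label_comp; [|lia|lia|lia|lia].
case: comp_labelP; rewrite ?eqxx //; first lia; move=> *;
  (case: comp_labelP => //; first lia); move=> *; try (exfalso; lia);
  match goal with
  | H : is_true (label p ?a ?b != 1%g) |- _ =>
      by apply: (ncp a _ b _ _ _ _ H); lia
  | H : is_true (label q ?a ?b != 1%g) |- _ =>
      by apply: (ncq a _ b _ _ _ _ H); lia
  end.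
Qed.

Lemma val_ncclique_cast n m (e : n = m) (p : ncclique n) :
  val (ecast a (ncclique a) e p) = ecast a (clique a) e (val p).
Proof. by case: _ / e. Qed.

Fact ncclique_unit_subproof : noncrossing clique_unit.
Proof. by apply/noncrossingP => *; apply: label0. Qed.

Definition ncclique_unit : ncclique 0 := exist _ clique_unit ncclique_unit_subproof.

Definition ncclique_comp n m (i : 'I_n.+1) (p : ncclique n) (q : ncclique m) :
    ncclique (n + m) :=
  exist _ (clique_comp i (val p) (val q)) (noncrossing_comp i (valP p) (valP q)).

Fact ncclique_seqA n m k (i : 'I_n.+1) (j : 'I_m.+1) x y z :
  ncclique_comp (inord (i + j) : 'I_(n + m).+1) (ncclique_comp i x y) z
  = ecast a (ncclique a) (addnA n m k) (ncclique_comp i x (@ncclique_comp m k j y z)).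
Proof. by apply: val_inj; rewrite val_ncclique_cast /= clique_seqA. Qed.

Fact ncclique_parA n m k (i j : 'I_n.+1) x (y : ncclique m) (z : ncclique k) :
  (i < j)%N ->
  ncclique_comp (inord (j + m) : 'I_(n + m).+1) (ncclique_comp i x y) z
  = ecast a (ncclique a) (addnAC n k m)
      (ncclique_comp (inord i : 'I_(n + k).+1) (ncclique_comp j x z) y).
Proof.
by move=> ltij; apply: val_inj; rewrite val_ncclique_cast /= clique_parA.
Qed.

Fact ncclique_unitl n (x : ncclique n) : ncclique_comp ord0 ncclique_unit x = x.
Proof. by apply: val_inj; rewrite /= clique_unitl. Qed.

Fact ncclique_unitr n (i : 'I_n.+1) (x : ncclique n) :
  ncclique_comp i x ncclique_unit = ecast a (ncclique a) (esym (addn0 n)) x.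
Proof. by apply: val_inj; rewrite val_ncclique_cast /= clique_unitr. Qed.

Definition ncclique_operad : set_operad :=
  @SetOperad (fun n => ncclique n) ncclique_unit ncclique_comp
    ncclique_seqA ncclique_parA ncclique_unitl ncclique_unitr.

Definition triangles : nat -> choiceType :=
  fun n => if n is 1 then clique 1 else void.

(* T(a; b, c): the base is the arc (0, 2), the first edge is (0, 1) and the
   second edge is (1, 2). *)
Definition triangle (a b c : M) : triangles 1 :=
  exist _ [ffun e : arc 1 =>
             if ((val e).1 == 0 :> nat)%N
             then if ((val e).2 == 1 :> nat)%N then b else a
             else c] isT.
End Cliques.

Definition NC (K : fieldType) (M : umagmaType) : operad K :=
  linear_operad K (ncclique_operad M).

Definition triangle_corolla (K : fieldType) (M : umagmaType) (a b c : M) :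
    free_operad K (triangles M) 1 :=
  corolla K (triangle a b c).

Section Relations.
Variables (K : fieldType) (M : umagmaType).
Local Notation T := (triangle_corolla K).

(* Partial compositions at the first and second inputs of a triangle are those
   at ord0 and ord_max in 'I_2. *)
Inductive NC_relator : free_operad K (triangles M) (1 + 1)%N -> Prop :=
| NC_relator1 (p0 p1 p2 q0 q1 q2 r0 r1 : M)
    of (p1 * q0 = r1 * r0)%g & (r1 * r0 <> 1)%g :
  NC_relator (T p0 p1 p2 \o_(ord0) T q0 q1 q2
              - T p0 r1 p2 \o_(ord0) T r0 q1 q2)
| NC_relator2 (p0 p1 p2 q0 q1 q2 r0 r2 : M)
    of (p1 * q0 = r2 * r0)%g & (r2 * r0 = 1)%g :
  NC_relator (T p0 p1 p2 \o_(ord0) T q0 q1 q2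
              - T p0 q1 r2 \o_(ord_max) T r0 q2 p2)
| NC_relator3 (p0 p1 p2 q0 q1 q2 r0 r2 : M)
    of (p2 * q0 = r2 * r0)%g & (r2 * r0 <> 1)%g :
  NC_relator (T p0 p1 p2 \o_(ord_max) T q0 q1 q2
              - T p0 p1 r2 \o_(ord_max) T r0 q1 q2).

Definition NC_relations : forall n, free_operad K (triangles M) n -> Prop :=
  in_degree (vect NC_relator).
End Relations.

(* Main.v *)
From HB Require Import structures.
Require Import Defs.
From mathcomp Require Import all_boot all_algebra.
From mathcomp Require Import generic_quotient boolp monalg zify.

Set Implicit Arguments.
Unset Strict Implicit.
Unset Printing Implicit Defensive.
Import GRing.Theory.
Local Open Scope ring_scope.
Local Open Scope quotient_scope.

(** A tree on the triangles is a binary tree, that is, a triangulation of a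
    polygon in which each inner diagonal carries two labels, one from each of
    the triangles it separates. Evaluating the tree in the operad of cliques
    ([tree_clique]) multiplies these two labels, so it remembers the solid arcs
    and forgets both the factorization of each label and the diagonals of the
    triangulation whose label is the unit. The relations undo exactly this:
    the first and the third change the factorization of a solid label, and the
    second flips a diagonal with unit label in its quadrilateral.

    Evaluation therefore kills the ideal of relations ([ideal_evaluation]), and
    it reaches every noncrossing clique, because the solid diagonals of such a
    clique extend to a triangulation ([tree_clique_surj]). The point is that
    two trees with the same evaluation are congruent modulo the ideal
    ([tree_clique_eqv]). This is proved with normal trees: all labels of inner
    diagonals are pushed to the upper triangle, and a diagonal hanging on the
    first edge of a triangle has to be solid. Flipping the other ones to the
    right shows that each tree is congruent to a normal one ([normal_form]).
    A normal tree is determined by its evaluation ([normal_unique]): the third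
    vertex of the triangle on the base is the farthest vertex joined to the
    vertex 0 by a solid arc other than the base, or the vertex 1 if there is no
    such arc.

    Sending a clique to the class of any of its triangulations is thus well
    defined and compatible with compositions; it is the required isomorphism,
    with the map induced by evaluation as its inverse. *)

(** * Trees of triangles and the labels of their arcs *)

Section TriangleTrees.
Variable M : umagmaType.
Implicit Types (a b c d e f : M) (t s l r : ptree (triangles M)).

Definition bin a b c l r : ptree (triangles M) :=
  @Node (triangles M) 1 (triangle a b c) [:: l; r].

Lemma label_triangle a b c :
  [/\ label (triangle a b c) 0 2 = a, label (triangle a b c) 0 1 = b
    & label (triangle a b c) 1 2 = c].
Proof.
have E (x y : nat) (e : Defs.arc 1) :
    ((val e).1 = x :> nat) /\ ((val e).2 = y :> nat) ->
    label (triangle a b c) x y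
    = if (x == 0)%N then if (y == 1)%N then b else a else c.
  by case=> <- <-; rewrite labelE ffunE.
by split; [have [e /E] := @arcP 1 0 2 isT isT
         | have [e /E] := @arcP 1 0 1 isT isT
         | have [e /E] := @arcP 1 1 2 isT isT].
Qed.

Lemma triangle_label (p : clique M 1) :
  p = triangle (label p 0 2) (label p 0 1) (label p 1 2).
Proof.
have [h1 h2 h3] := label_triangle (label p 0 2) (label p 0 1) (label p 1 2).
by apply: clique_eq => -[|[|x]] [|[|[|y]]].
Qed.

Lemma wf_bin a b c l r : wf (bin a b c l r) = wf l && wf r.
Proof. by rewrite /= andbT. Qed.

Lemma leaves_bin a b c l r : leaves (bin a b c l r) = (leaves l + leaves r)%N.
Proof. by rewrite /= addn0. Qed.

Lemma graft_bin s i a b c l r :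
  graft s i (bin a b c l r)
  = if (i < leaves l)%N then bin a b c (graft s i l) r
    else if (i - leaves l < leaves r)%N
         then bin a b c l (graft s (i - leaves l) r) else bin a b c l r.
Proof. by rewrite /bin graft_Node /=; case: ifP => // _; case: ifP. Qed.

(** Triangles being the only generators, well-formed trees are binary. *)
Lemma wf_tree_ind (P : ptree (triangles M) -> Prop) :
  P Leaf ->
  (forall a b c l r, wf l -> wf r -> P l -> P r -> P (bin a b c l r)) ->
  forall t, wf t -> P t.
Proof.
move=> PL PN; elim/ptree_ind' => // n g ts IH.
case: n g => [|[|n]] g //; try by case: g.
case: ts IH => [|l [|r [|]]] // IH.
rewrite (triangle_label g) -/(bin _ _ _ _ _) wf_bin => /andP[wl wr].
by apply: PN => //; apply: IH => //=; auto.
Qed.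

Lemma leaves_gt0 t : wf t -> (0 < leaves t)%N.
Proof.
elim/wf_tree_ind: t / => // a b c l r _ _ l0 r0.
by rewrite leaves_bin addn_gt0 l0.
Qed.

Lemma leaves1 t : wf t -> leaves t = 1 -> t = Leaf.
Proof.
elim/wf_tree_ind: t / => // a b c l r wl wr _ _.
by rewrite leaves_bin; have := leaves_gt0 wl; have := leaves_gt0 wr; lia.
Qed.

(** Generators outside arity 2 do not exist, which is what the default value
    stands for. *)
Definition generator_label n : triangles M n -> nat -> nat -> M :=
  if n is 1 then fun g x y => label g x y else fun=> fun=> fun=> 1%g.

(** The label of the arc (x, y) in the evaluation of the tree, computed directly
    on natural numbers, so that no arity has to be transported along an
    equation. The third vertex of the root triangle is [leaves l], and the base
    of a leaf has the unit label, which makes the two edge cases uniform. *)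
Fixpoint arc_label t (x y : nat) : M :=
  match t with
  | Node n g [:: l; r] =>
      if (x == 0)%N && (y == leaves l + leaves r)%N then generator_label g 0 2
      else if (x == 0)%N && (y == leaves l) then
        (generator_label g 0 1 * arc_label l x y)%g
      else if (x == leaves l) && (y == leaves l + leaves r)%N then
        (generator_label g 1 2 * arc_label r (x - leaves l) (y - leaves l))%g
      else if (y <= leaves l)%N then arc_label l x y
      else if (leaves l <= x)%N then arc_label r (x - leaves l) (y - leaves l)
      else 1%g
  | _ => 1%g
  end.

Lemma arc_label_bin a b c l r x y :
  arc_label (bin a b c l r) x y =
  if (x == 0)%N && (y == leaves l + leaves r)%N then a
  else if (x == 0)%N && (y == leaves l) then (b * arc_label l x y)%g
  else if (x == leaves l) && (y == leaves l + leaves r)%N then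
    (c * arc_label r (x - leaves l) (y - leaves l))%g
  else if (y <= leaves l)%N then arc_label l x y
  else if (leaves l <= x)%N then arc_label r (x - leaves l) (y - leaves l)
  else 1%g.
Proof. by rewrite /bin /=; have [-> -> ->] := label_triangle a b c. Qed.

(** The cases are split further than in [arc_label], so that each of them is a
    conjunction of linear conditions and inconsistent pairs of cases are refuted
    by arithmetic. *)
Variant arc_label_spec a b c l r (x y : nat) : M -> Prop :=
| ArcBase of x = 0 & y = (leaves l + leaves r)%N :
    arc_label_spec a b c l r x y a
| ArcEdge1 of x = 0 & y = leaves l :
    arc_label_spec a b c l r x y (b * arc_label l 0 (leaves l))%g
| ArcEdge2 of x = leaves l & y = (leaves l + leaves r)%N :
    arc_label_spec a b c l r x y (c * arc_label r 0 (leaves r))%g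
| ArcLeft1 of (y < leaves l)%N : arc_label_spec a b c l r x y (arc_label l x y)
| ArcLeft2 of (0 < x)%N & y = leaves l :
    arc_label_spec a b c l r x y (arc_label l x y)
| ArcRight1 of (leaves l < x)%N & (y <= leaves l + leaves r)%N :
    arc_label_spec a b c l r x y (arc_label r (x - leaves l) (y - leaves l))
| ArcRight2 of leaves l = x & (y < leaves l + leaves r)%N :
    arc_label_spec a b c l r x y (arc_label r (x - leaves l) (y - leaves l))
| ArcAcross1 of x = 0 & (leaves l < y)%N & (y < leaves l + leaves r)%N :
    arc_label_spec a b c l r x y 1%g
| ArcAcross2 of (0 < x)%N & (x < leaves l)%N & (leaves l < y)%N :
    arc_label_spec a b c l r x y 1%g.

Lemma arc_labelP a b c l r x y :
  (0 < leaves l)%N -> (0 < leaves r)%N ->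
  (x < y)%N -> (y <= leaves l + leaves r)%N ->
  arc_label_spec a b c l r x y (arc_label (bin a b c l r) x y).
Proof.
move=> l0 r0 ltxy ley; rewrite arc_label_bin.
have [/andP[/eqP-> /eqP->]|h1] := ifP; first exact: ArcBase.
have [/andP[/eqP-> /eqP->]|h2] := ifP; first exact: ArcEdge1.
have [/andP[/eqP-> /eqP->]|h3] := ifP.
  by rewrite subnn addKn; exact: ArcEdge2.
have [h4|h4] := ifP.
  have [|?] := ltnP y (leaves l); first exact: ArcLeft1.
  by apply: ArcLeft2; lia.
have [h5|h5] := ifP.
  by have [?|?] := ltnP (leaves l) x; [apply: ArcRight1|apply: ArcRight2]; lia.
by case: (posnP x) => ?; [apply: ArcAcross1|apply: ArcAcross2]; lia.
Qed.

Lemma arc_label_base a b c l r :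
  arc_label (bin a b c l r) 0 (leaves l + leaves r) = a.
Proof. by rewrite arc_label_bin !eqxx. Qed.

Lemma arc_label_leaf t x y : wf t -> leaves t = 1 -> arc_label t x y = 1%g.
Proof. by move=> wt /(leaves1 wt)->. Qed.

(** A solid arc of a tree stays on one side of the root triangle, hence so do
    two solid arcs that cross. *)
Lemma arc_label_noncrossing t x x' y y' :
  wf t -> (x < x')%N -> (x' < y)%N -> (y < y')%N -> (y' <= leaves t)%N ->
  arc_label t x y != 1%g -> arc_label t x' y' = 1%g.
Proof.
move=> wt; elim/wf_tree_ind: t / wt x x' y y' => // a b c l r wl wr IHl IHr.
have l0 := leaves_gt0 wl; have r0 := leaves_gt0 wr.
move=> x x' y y' h1 h2 h3; rewrite leaves_bin => h4.
case: arc_labelP => //; try lia; rewrite ?eqxx // => *;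
  (case: arc_labelP => //; try lia) => *; try (exfalso; lia);
  match goal with
  | H : is_true (arc_label l ?u ?v != 1%g) |- _ =>
      by apply: (IHl u _ v _ _ _ _ _ H); lia
  | H : is_true (arc_label r ?u ?v != 1%g) |- _ =>
      by apply: (IHr u _ v _ _ _ _ _ H); lia
  end.
Qed.

Definition represents n (p : clique M n) t :=
  forall x y, (x < y)%N -> (y <= n.+1)%N -> label p x y = arc_label t x y.

Lemma clique_of_labels n (L : nat -> nat -> M) :
  (n = 0%N -> L 0 1 = 1%g) ->
  exists p : clique M n,
    forall x y, (x < y)%N -> (y <= n.+1)%N -> label p x y = L x y.
Proof.
move=> L1; pose f := [ffun e : Defs.arc n => L (val e).1 (val e).2].
have fP : (n == 0)%N ==> [forall e, f e == 1%g].
  apply/implyP=> /eqP n0; apply/forallP => e; rewrite ffunE -(L1 n0).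
  have := valP e; have := ltn_ord (val e).2.
  move: (val e) => [[x ?] [y ?]] /= *.
  by apply/eqP; congr (L _ _); lia.
exists (exist _ f fP) => x y ltxy ley.
have [e [<- <-]] := arcP ltxy ley.
by rewrite labelE ffunE.
Qed.

Lemma represents_exists n t : wf t -> leaves t = n.+1 ->
  exists p : clique M n, represents p t.
Proof.
by move=> wt et; apply: clique_of_labels => n0; apply: arc_label_leaf; lia.
Qed.

(* Unfolds every label of a composite by position of its arc, and discards the
   combinations of positions that are inconsistent. *)
Local Ltac split_labels :=
  repeat (match goal with
  | |- context [arc_label (bin _ _ _ _ _) _ _] => case: arc_labelP
  | |- context [comp_label _ _ _ _ _] => case: comp_labelP
  end; try lia; move=> *; try (exfalso; lia)).

Local Ltac label_congr :=
  match goal with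
  | |- ?u = ?u => reflexivity
  | |- arc_label ?t _ _ = arc_label ?t _ _ => congr (arc_label t _ _); lia
  | |- label ?p _ _ = label ?p _ _ => congr (label p _ _); lia
  | |- (?u * label ?p _ _)%g = (?u * label ?p _ _)%g =>
      congr (u * label p _ _)%g; lia
  | |- (label ?p _ _ * ?u)%g = (label ?p _ _ * ?u)%g =>
      congr (label p _ _ * u)%g; lia
  | _ => idtac
  end.

(** Evaluation is a morphism: grafting s on a leaf of t glues the polygon of s on
    the corresponding edge of the polygon of t. *)
Lemma arc_label_graft s t n m (p : clique M n) (q : clique M m) i x y :
  wf t -> leaves t = n.+1 -> leaves s = m.+1 ->
  represents p t -> represents q s ->
  (i < leaves t)%N -> (x < y)%N -> (y <= (n + m).+1)%N ->
  arc_label (graft s i t) x y = comp_label p q i x y.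
Proof.
move=> wt + es + rq.
elim/wf_tree_ind: t / wt n p i x y => [|a b c l r wl wr IHl IHr] n p i x y.
  move=> [n0] rp; subst n; rewrite ltnS leqn0 => /eqP-> ltxy ley /=.
  have lab_s u v : (u < v)%N -> (v <= m.+1)%N -> arc_label s u v = label q u v.
    by move=> *; rewrite rq.
  case: comp_labelP => // *; try (exfalso; lia);
    by rewrite ?label0 ?mul1g; subst; rewrite ?subn0 lab_s.
have l0 := leaves_gt0 wl; have r0 := leaves_gt0 wr.
rewrite leaves_bin => en rp lti ltxy ley.
have subclique u : wf u ->
    exists nu (pu : clique M nu), leaves u = nu.+1 /\ represents pu u.
  move=> wu; have /prednK eu := leaves_gt0 wu.
  by have [pu ru] := represents_exists wu (esym eu); exists (leaves u).-1, pu.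
have [nl [pl [enl rl]]] := subclique l wl.
have [nr [pr [enr rr]]] := subclique r wr.
have {}IHl := IHl _ pl _ _ _ enl rl.
have {}IHr := IHr _ pr _ _ _ enr rr.
rewrite graft_bin; case: ltnP => lti'.
{ have eg := leaves_graft s lti'.
  split_labels; rewrite ?IHl ?rp; try lia; subst.
  all: split_labels; rewrite // -?rl; try lia.
  all: split_labels; label_congr.
  (* Here l is a single leaf, replaced by s as a whole: of the three labels to be
     multiplied one is the unit, so the two bracketings agree in a magma. *)
  have nl0 : nl = 0%N by lia.
  by clear -nl0; subst nl; rewrite !label0 mulg1 mul1g. }
have lti2 : (i - leaves l < leaves r)%N by lia.
rewrite lti2; have eg := leaves_graft s lti2.
split_labels; rewrite ?IHr ?rp; try lia; subst.
all: split_labels; rewrite // -?rr; try lia.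
all: split_labels; label_congr.
have nr0 : nr = 0%N by lia.
by clear -nr0; subst nr; rewrite !label0 mulg1 mul1g.
Qed.
End TriangleTrees.

(** * Normal trees *)

Section NormalTrees.
Variable M : umagmaType.
Implicit Types (a b c d e f : M) (t s l r : ptree (triangles M)).

(** Labels of inner diagonals are carried by the upper triangle only, and the
    first edge of a triangle is a leaf or a solid diagonal. The latter choice
    singles out one of the triangulations related by flips. *)
Inductive normal : ptree (triangles M) -> Prop :=
| NormalLeaf : normal Leaf
| NormalBin a b c l r of normal l & normal r
    & arc_label l 0 (leaves l) = 1%g & arc_label r 0 (leaves r) = 1%g
    & ((1 < leaves l)%N -> b <> 1%g) :
  normal (bin a b c l r).

Lemma normal_wf t : normal t -> wf t.
Proof.
elim=> // a b c l r _ wl _ wr _ _ _.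
by rewrite wf_bin wl wr.
Qed.

Section Bin.
Variables (a b c : M) (l r : ptree (triangles M)).
Hypotheses (l0 : (0 < leaves l)%N) (r0 : (0 < leaves r)%N).
Let t := bin a b c l r.

Lemma arc_label_edge1 :
  arc_label t 0 (leaves l) = (b * arc_label l 0 (leaves l))%g.
Proof. by case: arc_labelP => //; lia. Qed.

Lemma arc_label_edge2 :
  arc_label t (leaves l) (leaves l + leaves r)
  = (c * arc_label r 0 (leaves r))%g.
Proof. by case: arc_labelP => //; lia. Qed.

Lemma arc_label_left x y : (x < y)%N -> (y <= leaves l)%N ->
  (x, y) != (0, leaves l)%N -> arc_label t x y = arc_label l x y.
Proof.
move=> ltxy ley; rewrite xpair_eqE => ne.
by case: arc_labelP => //; lia.
Qed.

Lemma arc_label_right x y : (x < y)%N -> (y <= leaves r)%N ->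
  (x, y) != (0, leaves r)%N ->
  arc_label t (x + leaves l) (y + leaves l) = arc_label r x y.
Proof.
move=> ltxy ley; rewrite xpair_eqE => ne.
by case: arc_labelP; rewrite ?addnK //; lia.
Qed.

Lemma arc_label_across y : (leaves l < y)%N -> (y < leaves l + leaves r)%N ->
  arc_label t 0 y = 1%g.
Proof. by move=> *; case: arc_labelP => //; lia. Qed.
End Bin.

(** The evaluation determines the third vertex k of the root triangle: every arc
    from 0 lying strictly between (0, k) and the base crosses the root triangle
    and has the unit label, whereas (0, k) is solid unless k = 1. *)
Lemma normal_unique t s : normal t -> normal s -> leaves t = leaves s ->
  (forall x y, (x < y)%N -> (y <= leaves t)%N ->
     arc_label t x y = arc_label s x y) ->
  t = s.
Proof.
move=> nt; elim: nt s => [|a b c l r nl IHl nr IHr bl br bN1] s ns.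
  by move=> /esym/(leaves1 (normal_wf ns))->.
have l0 := leaves_gt0 (normal_wf nl); have r0 := leaves_gt0 (normal_wf nr).
case: ns => [|a' b' c' l' r' nl' nr' bl' br' bN1'].
  by rewrite leaves_bin /=; lia.
have l0' := leaves_gt0 (normal_wf nl'); have r0' := leaves_gt0 (normal_wf nr').
rewrite !leaves_bin => en E.
have ea : a = a'.
  have := E 0%N (leaves l + leaves r)%N ltac:(lia) ltac:(lia).
  by rewrite arc_label_base en arc_label_base.
have el : leaves l = leaves l'.
  have [lt|lt|//] := ltngtP (leaves l) (leaves l').
    have /esym := E 0%N (leaves l') ltac:(lia) ltac:(lia).
    rewrite arc_label_edge1 // arc_label_across // ?bl' ?mulg1; last lia.
    by move/bN1'; lia.
  have := E 0%N (leaves l) ltac:(lia) ltac:(lia).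
  rewrite arc_label_edge1 // arc_label_across // ?bl ?mulg1; last lia.
  by move/bN1; lia.
have er : leaves r = leaves r' by lia.
have eb : b = b'.
  have := E 0%N (leaves l) ltac:(lia) ltac:(lia).
  by rewrite arc_label_edge1 // el arc_label_edge1 // -el bl el bl' !mulg1.
have ec : c = c'.
  have := E (leaves l) (leaves l + leaves r)%N ltac:(lia) ltac:(lia).
  by rewrite arc_label_edge2 // el er arc_label_edge2 // -er br er br' !mulg1.
congr bin => //.
  apply: IHl => // x y ltxy ley.
  have [[-> ->]|ne] := eqVneq (x, y) (0, leaves l)%N; first by rewrite bl el bl'.
  have := E x y ltxy ltac:(lia).
  by rewrite !arc_label_left -?el.
apply: IHr => // x y ltxy ley.
have [[-> ->]|ne] := eqVneq (x, y) (0, leaves r)%N; first by rewrite br er br'.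
have := E (x + leaves l)%N (y + leaves l)%N ltac:(lia) ltac:(lia).
by rewrite arc_label_right // el arc_label_right -?er.
Qed.

(** Every noncrossing labelling comes from a triangulation. The third vertex j of
    the triangle on the base is the one of the normal tree; no solid arc crosses
    that triangle, either because (0, j) is itself solid or because j = 1 and
    nothing solid leaves 0. The two remaining polygons are triangulated after
    resetting their bases to the unit. *)
Lemma tree_of_labels n (L : nat -> nat -> M) :
  (0 < n)%N -> (n = 1%N -> L 0 1 = 1%g) ->
  (forall x x' y y', (x < x')%N -> (x' < y)%N -> (y < y')%N -> (y' <= n)%N ->
     L x y != 1%g -> L x' y' = 1%g) ->
  exists t, [/\ wf t, leaves t = n &
    forall x y, (x < y)%N -> (y <= n)%N -> arc_label t x y = L x y].
Proof.
elim/ltn_ind: n L => n IH L n0 L1 ncL.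
have [n1|n_gt1] : n = 1%N \/ (1 < n)%N by lia.
  exists Leaf; split=> // x y ltxy ley /=.
  by rewrite -(L1 n1); congr (L _ _); lia.
pose apex j := (0 < j)%N && (j < n)%N && ((j == 1)%N || (L 0 j != 1%g)).
have [j /andP[/andP[j0 ltjn] jP] jmax] :
    exists2 j, apex j & forall k, apex k -> (k <= j)%N.
  have ex : exists j, apex j by exists 1%N; rewrite /apex n_gt1.
  have ub k : apex k -> (k <= n)%N by case/andP=> /andP[_ /ltnW].
  by case: (ex_maxnP ex ub) => j; exists j.
have across x y : (x < j)%N -> (j < y)%N -> (y <= n)%N -> (x, y) != (0, n)%N ->
    L x y = 1%g.
  rewrite xpair_eqE => ltxj ltjy leyn ne; case: (posnP x) => [x0|x0].
    rewrite x0 in ne *; apply/eqP/negPn/negP => Ly; have := jmax y.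
    by rewrite /apex Ly orbT; lia.
  by case/orP: jP => [|jP]; [lia | apply: (ncL 0%N x j y) => //].
pose side k n' x y :=
  if (x, y) == (0, n')%N then 1%g else L (x + k)%N (y + k)%N.
have sideP k n' : (0 < n')%N -> (n' < n)%N -> (n' + k <= n)%N ->
    exists t, [/\ wf t, leaves t = n' &
      forall x y, (x < y)%N -> (y <= n')%N -> arc_label t x y = side k n' x y].
  move=> n'0 ltn' len'; apply: IH => // [->|x x' y y' h1 h2 h3 h4].
    by rewrite /side eqxx.
  rewrite /side !xpair_eqE; case: ifP => [|_ Lxy]; first by rewrite eqxx.
  case: ifP => // _; apply: (ncL (x + k)%N _ (y + k)%N); lia.
have [l [wl el El]] := sideP 0%N j j0 ltjn ltac:(lia).
have [r [wr er Er]] := sideP j (n - j)%N ltac:(lia) ltac:(lia) ltac:(lia).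
exists (bin (L 0%N n) (L 0%N j) (L j n) l r).
rewrite wf_bin wl wr leaves_bin el er; split=> //; first lia.
move=> x y ltxy ley.
have [l0 r0] : (0 < leaves l)%N /\ (0 < leaves r)%N by lia.
case: arc_labelP => //; try lia; rewrite ?el ?er.
- by move=> -> ->; congr (L _ _); lia.
- by move=> -> ->; rewrite El // /side eqxx mulg1.
- by move=> -> ->; rewrite Er ?/side ?eqxx ?mulg1; [congr (L _ _) | |]; lia.
- move=> h; rewrite El /side ?xpair_eqE ?ifF ?addn0 //; lia.
- move=> h1 h2; rewrite El /side ?xpair_eqE ?ifF ?addn0 //; lia.
- move=> h1 h2; rewrite Er /side ?xpair_eqE ?ifF ?subnK //; lia.
- move=> h1 h2; rewrite Er /side ?xpair_eqE ?ifF ?subnK //; lia.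
- by move=> h1 h2 h3; rewrite across // ?xpair_eqE; lia.
- by move=> h1 h2 h3; rewrite across // ?xpair_eqE; lia.
Qed.
End NormalTrees.

(** * The clique of a tree *)

Section TreeClique.
Variable M : umagmaType.

Lemma tree_clique_exists n (t : tree (triangles M) n) :
  exists p : ncclique M n, represents (val p) (val t).
Proof.
have /andP[wt /eqP et] := valP t.
have [p rp] := represents_exists wt et.
have ncp : noncrossing p.
  apply/noncrossingP => x x' y y' h1 h2 h3.
  have [ley'|gty'] := leqP y' n.+1; last by move=> _; apply: label_out; lia.
  rewrite !rp; try lia.
  by apply: arc_label_noncrossing; rewrite ?et.
by exists (exist _ p ncp).
Qed.

Definition tree_clique n (t : tree (triangles M) n) : ncclique M n :=
  projT1 (cid (tree_clique_exists t)).

Lemma tree_cliqueP n (t : tree (triangles M) n) :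
  represents (val (tree_clique t)) (val t).
Proof. exact: projT2 (cid (tree_clique_exists t)). Qed.

Lemma tree_clique_unique n (t : tree (triangles M) n) (p : ncclique M n) :
  represents (val p) (val t) -> tree_clique t = p.
Proof.
move=> rp; apply/val_inj/clique_eq => x y ltxy ley.
by rewrite tree_cliqueP // rp.
Qed.

Lemma tree_clique_eq n (t s : tree (triangles M) n) :
  (forall x y, (x < y)%N -> (y <= n.+1)%N ->
     arc_label (val t) x y = arc_label (val s) x y) ->
  tree_clique t = tree_clique s.
Proof.
by move=> E; apply: tree_clique_unique => x y *; rewrite tree_cliqueP // E.
Qed.

Lemma tree_clique_comp n m (i : 'I_n.+1)
    (t : tree (triangles M) n) (s : tree (triangles M) m) :
  tree_clique (tree_comp i t s) = ncclique_comp i (tree_clique t) (tree_clique s).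
Proof.
apply: tree_clique_unique => x y ltxy ley.
have /andP[wt /eqP et] := valP t; have /andP[ws /eqP es] := valP s.
rewrite label_comp //; apply/esym/arc_label_graft => //; try exact: tree_cliqueP.
by rewrite et.
Qed.

Lemma tree_clique_unit : tree_clique (tree_unit _) = ncclique_unit M.
Proof. by apply/val_inj/clique_eq => x y _ _; rewrite !label0. Qed.

Lemma tree_clique_surj n (p : ncclique M n) :
  exists t : tree (triangles M) n, tree_clique t = p.
Proof.
have /noncrossingP ncp := valP p.
have [||x x' y y' h1 h2 h3 _|t [wt et Et]] :=
    @tree_of_labels M n.+1 (label (val p)) => //.
- by case=> n0; subst n; apply: label0.
- exact: ncp.
have wet : wf t && (leaves t == n.+1) by rewrite wt et eqxx.
exists (exist _ t wet); apply: tree_clique_unique => x y *.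
by rewrite Et.
Qed.
End TreeClique.

(** * Evaluation and congruence modulo the relations *)

Section Congruence.
Variables (K : fieldType) (M : umagmaType).
Implicit Types (a b c d e f : M) (t s l r : ptree (triangles M)).
Local Notation T := (free_operad K (triangles M)).
Local Notation ideal := (generated_ideal (@NC_relations K M)).

Definition evaluation n : T n -> NC K M n :=
  lext (fun t : tree (triangles M) n => << tree_clique t >>).

HB.instance Definition _ n :=
  GRing.isLinear.Build K (T n) (NC K M n) _ (@evaluation n) (@lext_is_linear _ _ _ _).

Lemma evaluationU n (t : tree (triangles M) n) :
  evaluation << t >> = << tree_clique t >>.
Proof. by rewrite /evaluation lextU. Qed.

Lemma evaluation_comp n m (i : 'I_n.+1) (x : T n) (y : T m) :
  evaluation (x \o_(i) y) = evaluation x \o_(i) evaluation y.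
Proof.
move: x; apply: lin_ext => [k u v|k u v|t]; first by rewrite op_compl linearP.
  by rewrite linearP op_compl.
move: y; apply: lin_ext => [k u v|k u v|s]; first by rewrite op_compr linearP.
  by rewrite linearP op_compr.
by rewrite /= lin_compU !evaluationU lin_compU tree_clique_comp.
Qed.

Fact evaluation_ker_subspace n : is_subspace (fun x : T n => evaluation x = 0).
Proof.
split=> [|k u v u0 v0]; first exact: (raddf0 (@evaluation n)).
by rewrite (linearP (@evaluation n)) /= u0 v0 scaler0 addr0.
Qed.

Fact evaluation_ker_compl n m (i : 'I_n.+1) (x : T n) (y : T m) :
  evaluation x = 0 -> evaluation (x \o_(i) y) = 0.
Proof. by move=> x0; rewrite evaluation_comp x0 -(subrr 0) op_compBl subrr. Qed.

Fact evaluation_ker_compr n m (i : 'I_n.+1) (x : T n) (y : T m) :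
  evaluation y = 0 -> evaluation (x \o_(i) y) = 0.
Proof. by move=> y0; rewrite evaluation_comp y0 -(subrr 0) op_compBr subrr. Qed.

Definition evaluation_ker : operad_ideal T :=
  OperadIdeal evaluation_ker_subspace evaluation_ker_compl evaluation_ker_compr.

Lemma corolla_comp_first a b c d e f :
  exists t : tree (triangles M) (1 + 1)%N,
    val t = bin a b c (bin d e f Leaf Leaf) Leaf /\
    triangle_corolla K a b c \o_(ord0) triangle_corolla K d e f
    = << t >> :> T (1 + 1)%N.
Proof.
exists (tree_comp ord0 (corolla_tree (triangle a b c))
          (corolla_tree (triangle d e f))).
by split=> //; rewrite /= lin_compU.
Qed.

Lemma corolla_comp_second a b c d e f :
  exists t : tree (triangles M) (1 + 1)%N,
    val t = bin a b c Leaf (bin d e f Leaf Leaf) /\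
    triangle_corolla K a b c \o_(ord_max) triangle_corolla K d e f
    = << t >> :> T (1 + 1)%N.
Proof.
exists (tree_comp ord_max (corolla_tree (triangle a b c))
          (corolla_tree (triangle d e f))).
by split=> //; rewrite /= lin_compU.
Qed.

Lemma evaluation_sub_eq0 n (x y : T n) (t s : tree (triangles M) n) :
  x = << t >> -> y = << s >> ->
  (forall i j, (i < j)%N -> (j <= n.+1)%N ->
     arc_label (val t) i j = arc_label (val s) i j) ->
  evaluation (x - y) = 0.
Proof.
move=> -> -> /tree_clique_eq e.
have E : evaluation << t >> = evaluation << s >>.
  have E : << tree_clique t >> = << tree_clique s >> :> NC K M n by rewrite e.
  exact: (etrans (evaluationU t) (etrans E (esym (evaluationU s)))).
apply: (etrans (raddfB (@evaluation n) << t >> << s >>)).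
by apply/eqP; rewrite subr_eq0; apply/eqP.
Qed.

Local Ltac three_leaf_labels :=
  move=> [|[|[|x']]] [|[|[|[|y']]]] // _ _;
  rewrite !arc_label_bin /= ?arc_label_bin /=.

(** Both sides of a relator are triangulated quadrilaterals with the same labels:
    the hypothesis of the relator equates the labels of the diagonals. *)
Lemma relations_evaluation n (x : T n) : NC_relations x -> evaluation x = 0.
Proof.
case=> {n x} x /(_ (fun x => evaluation x = 0)); apply.
  exact: evaluation_ker_subspace.
move=> _ [p0 p1 p2 q0 q1 q2 r0 r1 e1 _|p0 p1 p2 q0 q1 q2 r0 r2 e1 e2|
          p0 p1 p2 q0 q1 q2 r0 r2 e1 _].
- have [t [vt et]] := corolla_comp_first p0 p1 p2 q0 q1 q2.
  have [s [vs es]] := corolla_comp_first p0 r1 p2 r0 q1 q2.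
  apply: (evaluation_sub_eq0 et es); rewrite {et es} vt vs.
  by three_leaf_labels; rewrite ?mulg1 ?e1 ?e2.
- have [t [vt et]] := corolla_comp_first p0 p1 p2 q0 q1 q2.
  have [s [vs es]] := corolla_comp_second p0 q1 r2 r0 q2 p2.
  apply: (evaluation_sub_eq0 et es); rewrite {et es} vt vs.
  by three_leaf_labels; rewrite ?mulg1 ?e1 ?e2.
have [t [vt et]] := corolla_comp_second p0 p1 p2 q0 q1 q2.
have [s [vs es]] := corolla_comp_second p0 p1 r2 r0 q1 q2.
apply: (evaluation_sub_eq0 et es); rewrite {et es} vt vs.
by three_leaf_labels; rewrite ?mulg1 ?e1 ?e2.
Qed.

(** The kernel of evaluation is an operad ideal containing the relations, hence
    it contains the ideal they generate. *)
Lemma ideal_evaluation n (x : T n) : id_mem ideal x -> evaluation x = 0.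
Proof. by move=> Ix; apply: (Ix evaluation_ker) => k r /relations_evaluation. Qed.

(** Congruence modulo the ideal is stated on bare trees, whose arity is read off
    from the leaves, so that grafting involves no cast. It is an inductive type
    rather than a definition in order that unification never unfolds basis
    vectors of the free operad when it compares two trees. *)
Variant eqv : ptree (triangles M) -> ptree (triangles M) -> Prop :=
| Eqv n (t s : tree (triangles M) n) of id_mem ideal (<< t >> - << s >> : T n) :
    eqv (val t) (val s).

Lemma eqvP n (t s : tree (triangles M) n) :
  eqv (val t) (val s) -> id_mem ideal (<< t >> - << s >> : T n).
Proof.
move et : (val t) => u; move es : (val s) => v H.
case: H et es => m t' s' h et es.
have nm : n = m by apply: succn_inj; rewrite -(leaves_tree t) et leaves_tree.
by subst m; rewrite (val_inj et) (val_inj es).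
Qed.

Lemma eqv_refl t : wf t -> eqv t t.
Proof.
move=> wt; have wlt : wf t && (leaves t == (leaves t).-1.+1).
  by rewrite wt prednK ?leaves_gt0 //=.
apply: (@Eqv (leaves t).-1 (exist _ t wlt) (exist _ t wlt)).
by rewrite subrr; exact: (id_subspace ideal _).1.
Qed.

Lemma eqv_lift t s : eqv t s ->
  exists n (u v : tree (triangles M) n), t = val u /\ s = val v.
Proof. by case=> n u v _; exists n, u, v. Qed.

Lemma tree_lift t : wf t -> exists n (u : tree (triangles M) n), t = val u.
Proof. by case/eqv_refl/eqv_lift=> n [u [_ [-> _]]]; exists n, u. Qed.

Lemma eqv_wf t s : eqv t s -> [/\ wf t, wf s & leaves t = leaves s].
Proof.
case/eqv_lift=> n [u [v [-> ->]]]; rewrite !leaves_tree.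
by have /andP[-> _] := valP u; have /andP[-> _] := valP v.
Qed.

Lemma eqv_sym t s : eqv t s -> eqv s t.
Proof.
case=> n u v h; apply: Eqv.
by rewrite -opprB -scaleN1r; apply: id_memZ.
Qed.

Lemma eqv_trans s t r : eqv t s -> eqv s r -> eqv t r.
Proof.
move=> ets esr; have [n [u [v [et es]]]] := eqv_lift ets.
have [m [v' [w [es' er]]]] := eqv_lift esr.
have mn : m = n.
  by apply: succn_inj; rewrite -(leaves_tree v') -es' es leaves_tree.
subst m t s r; have ev : v' = v := esym (val_inj es'); subst v'.
apply: Eqv; have h1 := eqvP ets; have h2 := eqvP esr.
have := id_memD h1 h2.
rewrite (addrA (<< u >> - << v >>)) (subrK << v >>); exact: id.
Qed.

Lemma eqv_graftl s t t' i : wf s -> (i < leaves t)%N -> eqv t t' ->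
  eqv (graft s i t) (graft s i t').
Proof.
case/tree_lift=> m [s' ->] + H; case: H => n u u' h; rewrite leaves_tree => lti.
apply: (@Eqv _ (tree_comp (Ordinal lti) u s') (tree_comp (Ordinal lti) u' s')).
have := @id_compl _ _ ideal _ _ (Ordinal lti) _ (<< s' >> : T _) h.
have -> : (<< u >> - << u' >> : T n) \o_(Ordinal lti) (<< s' >> : T m)
    = << tree_comp (Ordinal lti) u s' >> - << tree_comp (Ordinal lti) u' s' >>.
  apply: etrans (op_compBl _ _ _ _) _.
  by congr (_ - _); apply: lin_compU.
exact: id.
Qed.

Lemma eqv_graftr s s' t i : wf t -> (i < leaves t)%N -> eqv s s' ->
  eqv (graft s i t) (graft s' i t).
Proof.
case/tree_lift=> m [t' ->] + H; case: H => n u u' h; rewrite leaves_tree => lti.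
apply: (@Eqv _ (tree_comp (Ordinal lti) t' u) (tree_comp (Ordinal lti) t' u')).
have := @id_compr _ _ ideal _ _ (Ordinal lti) (<< t' >> : T _) _ h.
have -> : (<< t' >> : T m) \o_(Ordinal lti) (<< u >> - << u' >> : T n)
    = << tree_comp (Ordinal lti) t' u >> - << tree_comp (Ordinal lti) t' u' >>.
  apply: etrans (op_compBr _ _ _ _) _.
  by congr (_ - _); apply: lin_compU.
exact: id.
Qed.

Lemma eqv_bin a b c l l' r r' : eqv l l' -> eqv r r' ->
  eqv (bin a b c l r) (bin a b c l' r').
Proof.
move=> el er; have [wl wl' ell] := eqv_wf el; have [wr wr' err] := eqv_wf er.
have l0 := leaves_gt0 wl.
apply: (@eqv_trans (bin a b c l' r)).
  have := @eqv_graftr l l' (bin a b c Leaf r) 0.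
  by rewrite !graft_bin /=; apply; rewrite ?wr.
have := @eqv_graftr r r' (bin a b c l' Leaf) (leaves l').
by rewrite !graft_bin ltnn subnn /=; apply; rewrite ?wl' //; lia.
Qed.

End Congruence.

Lemma malgU_inj (K : fieldType) (S : choiceType) :
  injective (fun k : S => << k >> : {malg K[S]}).
Proof.
move=> k l /(congr1 (mcoeff l)); rewrite !mcoeffU eqxx.
by case: eqP => // _ /eqP; rewrite eq_sym oner_eq0.
Qed.

(** * Reduction to normal trees *)

Section Rewriting.
Variables (K : fieldType) (M : umagmaType).
Implicit Types (a b c d e f : M) (t s l r : ptree (triangles M)).
Local Notation T := (free_operad K (triangles M)).
Local Notation ideal := (generated_ideal (@NC_relations K M)).
Local Notation eqv := (@eqv K M).

Lemma relator_eqv (x y : T (1 + 1)%N) (t s : tree (triangles M) (1 + 1)%N) :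
  x = << t >> -> y = << s >> -> NC_relator (x - y) -> eqv (val t) (val s).
Proof.
move=> -> -> R; apply: Eqv => I RI.
by apply/RI/InDegree => W _; apply.
Qed.

(** Grafting is done from right to left, so that the positions of the leaves still
    to be filled do not move. *)
Lemma eqv_fill t s A B C : wf A -> wf B -> wf C -> eqv t s -> leaves t = 3 ->
  eqv (graft A 0 (graft B 1 (graft C 2 t)))
      (graft A 0 (graft B 1 (graft C 2 s))).
Proof.
move=> wA wB wC ets et.
have lt2 : (2 < leaves t)%N by rewrite et.
have e1 := leaves_graft C lt2.
have lt1 : (1 < leaves (graft C 2 t))%N by have := leaves_gt0 wC; lia.
have e0 := leaves_graft B lt1.
have lt0 : (0 < leaves (graft B 1 (graft C 2 t)))%N by have := leaves_gt0 wB; lia.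
by do 3! (apply: eqv_graftl => //).
Qed.

Section Rules.
Variables (A B C : ptree (triangles M)).
Hypotheses (wA : wf A) (wB : wf B) (wC : wf C).

Lemma eqv_left (p0 p1 p2 q0 q1 q2 r0 r1 : M) :
  (p1 * q0 = r1 * r0)%g -> (r1 * r0 <> 1)%g ->
  eqv (bin p0 p1 p2 (bin q0 q1 q2 A B) C) (bin p0 r1 p2 (bin r0 q1 q2 A B) C).
Proof.
move=> e ne; have := NC_relator1 K p0 p2 q1 q2 e ne.
have [t [vt et]] := corolla_comp_first K p0 p1 p2 q0 q1 q2.
have [s [vs es]] := corolla_comp_first K p0 r1 p2 r0 q1 q2.
move/(relator_eqv et es); rewrite vt vs => /(eqv_fill wA wB wC)/(_ erefl).
exact: id.
Qed.

Lemma eqv_flip (p0 p1 p2 q0 q1 q2 r0 r2 : M) :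
  (p1 * q0 = 1)%g -> (r2 * r0 = 1)%g ->
  eqv (bin p0 p1 p2 (bin q0 q1 q2 A B) C) (bin p0 q1 r2 A (bin r0 q2 p2 B C)).
Proof.
move=> e e'.
have := @NC_relator2 K M p0 p1 p2 q0 q1 q2 r0 r2 (etrans e (esym e')) e'.
have [t [vt et]] := corolla_comp_first K p0 p1 p2 q0 q1 q2.
have [s [vs es]] := corolla_comp_second K p0 q1 r2 r0 q2 p2.
move/(relator_eqv et es); rewrite vt vs => /(eqv_fill wA wB wC)/(_ erefl).
exact: id.
Qed.

(** When the diagonal is solid this is the third relation. Otherwise the diagonal
    is flipped away and back: flipping forgets how the unit was factored. *)
Lemma eqv_right (p0 p1 p2 q0 q1 q2 r0 r2 : M) :
  (p2 * q0 = r2 * r0)%g ->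
  eqv (bin p0 p1 p2 A (bin q0 q1 q2 B C)) (bin p0 p1 r2 A (bin r0 q1 q2 B C)).
Proof.
move=> e; have [e1|/eqP ne] := eqVneq (r2 * r0)%g 1%g.
  apply: (@eqv_trans _ _ (bin p0 1%g q2 (bin 1%g p1 q1 A B) C)).
    by apply/eqv_sym/eqv_flip; rewrite ?e ?mul1g.
  by apply: eqv_flip; rewrite ?mul1g.
have := NC_relator3 K p0 p1 q1 q2 e ne.
have [t [vt et]] := corolla_comp_second K p0 p1 p2 q0 q1 q2.
have [s [vs es]] := corolla_comp_second K p0 p1 r2 r0 q1 q2.
move/(relator_eqv et es); rewrite vt vs => /(eqv_fill wA wB wC)/(_ erefl).
exact: id.
Qed.
End Rules.

Lemma eqv_tree_clique n (u v : tree (triangles M) n) :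
  eqv (val u) (val v) -> tree_clique u = tree_clique v.
Proof.
move/eqvP/ideal_evaluation => E.
have {}E : evaluation (<< u >> : T n) = evaluation (<< v >> : T n).
  apply/eqP; rewrite -subr_eq0; apply/eqP.
  exact: etrans (esym (raddfB (@evaluation K M n) _ _)) E.
exact: malgU_inj (etrans (esym (evaluationU K u)) (etrans E (evaluationU K v))).
Qed.

Lemma eqv_arc_label t s : eqv t s ->
  forall x y, (x < y)%N -> (y <= leaves t)%N ->
    arc_label t x y = arc_label s x y.
Proof.
move=> E; have [n [u [v [et es]]]] := eqv_lift E; subst t s.
rewrite leaves_tree => x y *.
by rewrite -!tree_cliqueP // (eqv_tree_clique E).
Qed.

Lemma eqv_base t s : eqv t s ->
  arc_label t 0 (leaves t) = arc_label s 0 (leaves s).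
Proof.
move=> E; have [wt _ <-] := eqv_wf E.
by apply: eqv_arc_label; rewrite ?leaves_gt0.
Qed.

Lemma normal_right a b c l r : wf l -> normal r ->
  exists c' r', [/\ normal r', arc_label r' 0 (leaves r') = 1%g
                 & eqv (bin a b c l r) (bin a b c' l r')].
Proof.
move=> wl; case=> [|d e f rl rr nl nr el er ne].
  exists c, Leaf; split=> //; first exact: NormalLeaf.
  by apply: eqv_refl; rewrite wf_bin wl.
exists (c * d)%g, (bin 1%g e f rl rr); split.
- exact: NormalBin.
- by rewrite leaves_bin arc_label_base.
by apply: eqv_right; rewrite ?mulg1 //; apply: normal_wf.
Qed.

(** If the diagonal hanging on the first edge is solid, it suffices to push its
    label upwards. If it is not, it is flipped to the right; the subtree ll now
    on the first edge is as required since l was normal, and the new right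
    subtree is normalized by induction, its first subtree lr being smaller than
    l. *)
Lemma normal_join l r a b c : normal l -> normal r ->
  exists2 u, normal u & eqv (bin a b c l r) u.
Proof.
move=> nl.
elim: nl r a b c => [|d e f ll lr nll _ nlr IH ell elr ne] r a b c nr.
  have [c' [r' [nr' er' E]]] := @normal_right a b c Leaf r isT nr.
  exists (bin a b c' Leaf r') => //.
  by apply: NormalBin => //; apply: NormalLeaf.
have wll := normal_wf nll; have wlr := normal_wf nlr; have wr := normal_wf nr.
have [bd1|/eqP bdN1] := eqVneq (b * d)%g 1%g; last first.
  have wl : wf (bin 1%g e f ll lr) by rewrite wf_bin wll.
  have [c' [r' [nr' er' E]]] := @normal_right a (b * d)%g c _ r wl nr.
  exists (bin a (b * d)%g c' (bin 1%g e f ll lr) r').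
    apply: NormalBin => //; first exact: NormalBin.
    by rewrite leaves_bin arc_label_base.
  by apply: eqv_trans E; apply: eqv_left; rewrite ?mulg1.
have [u nu E] := IH r 1%g f c nr.
have eu : arc_label u 0 (leaves u) = 1%g.
  by rewrite -(eqv_base E) leaves_bin arc_label_base.
exists (bin a e 1%g ll u); first exact: NormalBin.
apply: (@eqv_trans _ _ (bin a e 1%g ll (bin 1%g f c lr r))).
  by apply: eqv_flip; rewrite ?mulg1.
by apply: eqv_bin E; apply: eqv_refl.
Qed.

Lemma normal_form t : wf t -> exists2 u, normal u & eqv t u.
Proof.
elim/wf_tree_ind: t / => [|a b c l r wl wr [l' nl' El] [r' nr' Er]].
  by exists Leaf; [apply: NormalLeaf | apply: eqv_refl].
have [u nu E] := normal_join a b c nl' nr'; exists u => //.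
by apply: eqv_trans E; apply: eqv_bin.
Qed.

(** Both trees are congruent to normal trees; congruence preserves evaluation, so
    these have the same evaluation and coincide. *)
Lemma tree_clique_eqv n (t s : tree (triangles M) n) :
  tree_clique t = tree_clique s -> eqv (val t) (val s).
Proof.
move=> e; have /andP[wt /eqP et] := valP t; have /andP[ws /eqP es] := valP s.
have [u nu tu] := normal_form wt; have [v nv sv] := normal_form ws.
suff uv : u = v by apply: eqv_trans tu _; rewrite uv; apply: eqv_sym.
have [_ _ etu] := eqv_wf tu; have [_ _ esv] := eqv_wf sv.
apply: normal_unique; rewrite -?etu -?esv ?et ?es // => x y ltxy ley.
rewrite -(eqv_arc_label tu) ?et // -(eqv_arc_label sv) ?es //.
by rewrite -!tree_cliqueP // e.
Qed.
End Rewriting.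

(** * The isomorphism *)

Section Isomorphism.
Variables (K : fieldType) (M : umagmaType).
Local Notation T := (free_operad K (triangles M)).
Local Notation ideal := (generated_ideal (@NC_relations K M)).
Local Notation Q := (quotient_operad ideal).

Definition triangulation n (p : ncclique M n) : tree (triangles M) n :=
  projT1 (cid (tree_clique_surj p)).

Lemma triangulationK n : cancel (@triangulation n) (@tree_clique M n).
Proof. by move=> p; exact: projT2 (cid (tree_clique_surj p)). Qed.

Definition tree_class n (t : tree (triangles M) n) : Q n :=
  \pi_(quo ideal n) (<< t >> : T n).

Lemma tree_class_eq n (t s : tree (triangles M) n) :
  tree_clique t = tree_clique s -> tree_class t = tree_class s.
Proof. by move/tree_clique_eqv => /(_ K)/eqvP/quo_eq. Qed.

Definition clique_class n : NC K M n -> Q n :=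
  lext (fun p : ncclique M n => tree_class (triangulation p)).

HB.instance Definition _ n :=
  GRing.isLinear.Build K (NC K M n) (Q n) _ (@clique_class n)
    (@lext_is_linear _ _ _ _).

Lemma clique_classU n (p : ncclique M n) :
  clique_class << p >> = tree_class (triangulation p).
Proof. by rewrite /clique_class lextU. Qed.

(** The map induced by evaluation on the quotient. *)
Definition class_clique n (x : Q n) : NC K M n := evaluation (repr x).

Lemma tree_class_comp n m (i : 'I_n.+1)
    (t : tree (triangles M) n) (s : tree (triangles M) m) :
  tree_class t \o_(i) tree_class s = tree_class (tree_comp i t s).
Proof.
apply: etrans (quo_compE ideal i (<< t >> : T n) (<< s >> : T m)) _.
congr (\pi_(quo ideal (n + m)) _); exact: lin_compU.
Qed.

(** The chosen triangulation of a composite is not the composite of the chosen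
    triangulations, but both evaluate to the same clique. *)
Lemma clique_class_comp n m (i : 'I_n.+1) (x : NC K M n) (y : NC K M m) :
  clique_class (x \o_(i) y) = clique_class x \o_(i) clique_class y.
Proof.
move: x; apply: lin_ext => [k u v|k u v|p].
- by rewrite op_compl (linearP (@clique_class _)).
- by rewrite (linearP (@clique_class _)) op_compl.
move: y; apply: lin_ext => [k u v|k u v|q].
- by rewrite op_compr (linearP (@clique_class _)).
- by rewrite (linearP (@clique_class _)) op_compr.
transitivity (clique_class (<< ncclique_comp i p q >> : NC K M (n + m)%N)).
  by congr clique_class; apply: lin_compU.
rewrite !clique_classU tree_class_comp; apply: tree_class_eq.
by rewrite triangulationK tree_clique_comp !triangulationK.
Qed.

Lemma clique_class_unit : clique_class (op_unit (NC K M)) = op_unit Q.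
Proof.
apply: etrans (clique_classU (ncclique_unit M)) _.
apply: (@tree_class_eq 0 _ (tree_unit _)).
by rewrite triangulationK tree_clique_unit.
Qed.

Lemma class_cliqueE n (x : T n) :
  class_clique (\pi_(quo ideal n) x : Q n) = evaluation x.
Proof.
apply/eqP; rewrite -subr_eq0 -(raddfB (@evaluation K M n)); apply/eqP.
exact/ideal_evaluation/quo_repr.
Qed.

Lemma class_clique_linear n : linear (@class_clique n).
Proof.
move=> k; elim/quo_ind=> u; elim/quo_ind=> v.
have -> : k *: (\pi_(quo ideal n) u : Q n) + (\pi_(quo ideal n) v : Q n)
    = \pi_(quo ideal n) (k *: u + v).
  by rewrite pi_quoD pi_quoZ.
by rewrite !class_cliqueE (linearP (@evaluation K M n)).
Qed.

Lemma clique_classK n : cancel (@clique_class n) (@class_clique n).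
Proof.
apply: lin_ext => [k u v|k u v|p] //.
  by rewrite (linearP (@clique_class n)) class_clique_linear.
rewrite clique_classU class_cliqueE evaluationU triangulationK; exact: erefl.
Qed.

Lemma class_cliqueK n : cancel (@class_clique n) (@clique_class n).
Proof.
elim/quo_ind=> x; rewrite class_cliqueE; move: x.
apply: lin_ext => [k u v|k u v|t].
- by rewrite (linearP (@evaluation K M n)) (linearP (@clique_class n)).
- by rewrite pi_quoD pi_quoZ.
by rewrite evaluationU clique_classU; apply: tree_class_eq; rewrite triangulationK.
Qed.

End Isomorphism.

Theorem theorem4p2p8 (K : fieldType) (charK : [pchar K] =i pred0)
    (M : finUMagmaType) :
  has_presentation (NC K M) (@NC_relations K M).
Proof.
exists (fun n => @clique_class K M n); split=> [n||n m i x y].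
- exact: Bijective (@clique_classK K M n) (@class_cliqueK K M n).
- exact: clique_class_unit.
exact: clique_class_comp.
Qed.
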